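(* Let $k\ge 2$ and $n>2k$ be integers. Let $K$ be the simplicial complex (on vertex set $T_{n,n}$) whose collection of maximal simplices is \[M_{n,k}=\{\pi_n(\sigma) : \sigma \text{ is a maximal simplex of } \mathrm{VR}(\mathbb{Z}^2;k)\}.\] Then $K$ is homotopy equivalent to the torus $S^1\times S^1$. Consequently, when $k\ge 2$ and $n>3k$, the complex $\mathrm{VR}(T_{n,n};k)$ is homotopy equivalent to the torus $S^1\times S^1$.
   Context: $\mathbb{Z}^2$ carries the $l^1$ metric $d((x,y),(x',y'))=|x-x'|+|y-y'|$. For a metric space $X$ and $r\ge 0$, the Vietoris--Rips complex $\mathrm{VR}(X;r)$ is the simplicial complex on vertex set $X$ whose simplices are the finite nonempty subsets of diameter at most $r$. $T_{n,n}$ denotes the set $\{0,\dots,n-1\}^2$ with metric $d((i,j),(i',j'))=\min\{|i-i'|,n-|i-i'|\}+\min\{|j-j'|,n-|j-j'|\}$ (the shortest-path metric of the $n\times n$ torus grid graph $C_n\,\square\,C_n$); it is identified with the quotient $\mathbb{Z}^2/(n\mathbb{Z}\times n\mathbb{Z})$ with the quotient metric, and $\pi_n:\mathbb{Z}^2\to T_{n,n}$ is the reduction of both coordinates mod $n$. A maximal simplex (facet) is a simplex not properly contained in another simplex. *)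

(* Defs.v *)
From HB Require Import structures.
From mathcomp Require Import all_boot all_order all_algebra.
From mathcomp Require Import all_classical all_reals all_analysis.
From mathcomp Require Import Rstruct Rstruct_topology.
From Stdlib Require Import Rdefinitions.

Set Implicit Arguments.
Unset Strict Implicit.
Unset Printing Implicit Defensive.

Import Order.TTheory GRing.Theory Num.Theory.

Local Open Scope classical_set_scope.
Local Open Scope ring_scope.

Definition cont_map {X Y : topologicalType} (A : set X) (B : set Y) (f : X -> Y) :=
  {within A, continuous f} /\ (forall x, A x -> B (f x)).

Definition homotopic {X Y : topologicalType} (A : set X) (B : set Y) (f g : X -> Y) :=
  exists H : (R * X)%type -> Y,
    cont_map [set p | (0 <= p.1 <= 1)%R /\ A p.2] B H /\
    (forall x, A x -> H (0%R, x) = f x) /\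
    (forall x, A x -> H (1%R, x) = g x).

Definition homotopy_equiv {X Y : topologicalType} (A : set X) (B : set Y) :=
  exists (f : X -> Y) (g : Y -> X),
    cont_map A B f /\ cont_map B A g /\
    homotopic A A (g \o f) id /\ homotopic B B (f \o g) id.

Definition torus : set ((R * R) * (R * R))%type :=
  [set p | p.1.1 ^+ 2 + p.1.2 ^+ 2 = 1 /\ p.2.1 ^+ 2 + p.2.2 ^+ 2 = 1].

Definition simplicial_complex (V : finType) (K : {set V} -> Prop) :=
  (forall s : {set V}, K s -> s != finset.set0) /\
  (forall s t : {set V}, K s -> t \subset s -> t != finset.set0 -> K t).

(* geometric realization |K| in R^V (product = Euclidean topology):
   barycentric coordinates whose support is a simplex of K *)
Definition realization (V : finType) (K : {set V} -> Prop) : set {ptws V -> R} :=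
  [set f | (forall v, 0 <= f v) /\ \sum_(v : V) f v = 1 /\
           K [set v | f v != 0]%SET].

Definition l1dist (x y : int * int) : int := `|x.1 - y.1| + `|x.2 - y.2|.

(* finite subsets of Z^2 are represented by (the members of) sequences *)
Definition diam_le (k : nat) (s : seq (int * int)) :=
  forall x y, x \in s -> y \in s -> l1dist x y <= k%:Z.

Definition VRZ2_simplex (k : nat) (s : seq (int * int)) :=
  s != [::] /\ diam_le k s.

Definition VRZ2_maximal (k : nat) (s : seq (int * int)) :=
  VRZ2_simplex k s /\
  forall t, VRZ2_simplex k t -> {subset s <= t} -> {subset t <= s}.

Definition pi_eq (n : nat) (x : int * int) (v : 'I_n * 'I_n) :=
  modz x.1 n%:Z = (v.1 : nat)%:Z /\ modz x.2 n%:Z = (v.2 : nat)%:Z.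

Definition M_simplex (n k : nat) (s : {set 'I_n * 'I_n}) :=
  exists sigma, VRZ2_maximal k sigma /\
    (forall v, v \in s <-> exists2 x, x \in sigma & pi_eq x v).

Definition K_complex (n k : nat) (s : {set 'I_n * 'I_n}) :=
  s != finset.set0 /\ exists2 t : {set 'I_n * 'I_n}, @M_simplex n k t & s \subset t.

Local Open Scope nat_scope.

(* shortest path metric of C_n box C_n *)
Definition cycdist (n a b : nat) : nat :=
  let d := ((a - b) + (b - a))%N in minn d (n - d)%N.

Definition torus_dist (n : nat) (v w : 'I_n * 'I_n) : nat :=
  (cycdist n v.1 w.1 + cycdist n v.2 w.2)%N.

Definition VR_torus (n k : nat) (s : {set 'I_n * 'I_n}) :=
  s != finset.set0 /\ forall v w, v \in s -> w \in s -> (@torus_dist n v w <= k)%N.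

(* Main.v *)
Require Import Defs.
From HB Require Import structures.
From mathcomp Require Import all_boot all_order all_algebra.
From mathcomp Require Import all_classical all_reals all_analysis.
From mathcomp Require Import Rstruct Rstruct_topology.
From mathcomp Require Import zify ring lra.

(** The complex [K] is deformed onto the image of the torus under a map [grid],
    which sends a point to the lattice points at distance less than 1 in each
    coordinate; a map back, [torus_mean], takes the barycenter of a lift to
    the plane.  The straight line from [p] to [grid (torus_mean p)] may leave
    [K], because rounding costs up to 2 in the l1 metric.  So [p] is first moved
    to a point [shrink p]: cut [p] into its superlevel sets [S], as in the
    barycentric subdivision, and replace each [S] by lattice points of its
    bounding box in the coordinates [x + y], [x - y] at distance at most [k - 1]
    from all of [S].  Since superlevel sets are nested, [p] and [shrink p] span
    a simplex and the support of [shrink p] has diameter at most [k - 1], after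
    which the rounding stays in [K].  Such lattice points fail to exist only
    for [k = 2] and sets inside a unit square containing one of its diagonals;
    then the support of [shrink p] stays in that square. *)

Set Implicit Arguments.
Unset Strict Implicit.
Unset Printing Implicit Defensive.

Import Order.TTheory GRing.Theory Num.Theory.

Local Open Scope ring_scope.

(** * Bounding boxes in the lattice *)

Definition diam_at_most (k : nat) (X : int * int -> Prop) :=
  forall x y, X x -> X y -> l1dist x y <= k%:Z.

(* [l1dist] is the sup metric in the coordinates [x + y] and [x - y]. *)
Definition box_hull (X : int * int -> Prop) (w : int * int) :=
  [/\ exists2 s, X s & s.1 + s.2 <= w.1 + w.2,
      exists2 s, X s & w.1 + w.2 <= s.1 + s.2,
      exists2 s, X s & s.1 - s.2 <= w.1 - w.2 &
      exists2 s, X s & w.1 - w.2 <= s.1 - s.2].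

Lemma sub_box_hull X w : X w -> box_hull X w.
Proof. by move=> Xw; split; exists w. Qed.

Lemma box_hull_mono (X Y : int * int -> Prop) w :
  (forall x, X x -> Y x) -> box_hull X w -> box_hull Y w.
Proof.
by move=> XY [[a /XY]] + + [b /XY] + + [c /XY] + + [d /XY] + +; split;
  [exists a|exists b|exists c|exists d].
Qed.

(** In the coordinates [x + y] and [x - y] a ball of [l1dist] is an axis-parallel box, so it
    contains the bounding box of every set inside it; each witness bounds one side. *)
Lemma l1dist_box_hull X w y (m : int) : box_hull X w ->
  (forall s, X s -> l1dist y s <= m) -> l1dist y w <= m.
Proof.
move=> [[a Xa ?] [b Xb ?] [c Xc ?] [d Xd ?]] Xm.
move: (Xm a Xa) (Xm b Xb) (Xm c Xc) (Xm d Xd); rewrite /l1dist; lia.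
Qed.

Lemma l1distC x y : l1dist x y = l1dist y x.
Proof. by rewrite /l1dist; lia. Qed.

Lemma diam_box_hull k X : diam_at_most k X -> diam_at_most k (box_hull X).
Proof.
move=> Xk x y hx hy; apply: (l1dist_box_hull hy) => s Xs.
by rewrite l1distC; apply: (l1dist_box_hull hx) => t Xt; exact: Xk.
Qed.

Definition near_center (k : nat) (X : int * int -> Prop) (w : int * int) :=
  box_hull X w /\ forall s, X s -> l1dist w s <= k%:Z - 1.

Definition unit_square (q x : int * int) :=
  (q.1 <= x.1 <= q.1 + 1) /\ (q.2 <= x.2 <= q.2 + 1).

Lemma box_hull_unit_square q X w :
  (forall x, X x -> unit_square q x) -> box_hull X w -> unit_square q w.
Proof.
move=> Xq [[a /Xq +  +] [b /Xq + +] [c /Xq + +] [d /Xq + +]].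
rewrite /unit_square; lia.
Qed.

Definition has_diagonal (q : int * int) (X : int * int -> Prop) :=
  (X q /\ X (q.1 + 1, q.2 + 1)) \/ (X (q.1 + 1, q.2) /\ X (q.1, q.2 + 1)).

(** Descent on the gap [h x0 - m]; [X] is an arbitrary predicate, so there is no list to scan. *)
Lemma exists_min_int (T : Type) (X : T -> Prop) (h : T -> int) (x0 : T) (m : int) :
  X x0 -> (forall x, X x -> m <= h x) -> exists2 x, X x & forall y, X y -> h x <= h y.
Proof.
move=> Xx0 hm; have [j] := ubnP `|h x0 - m|%N.
elim: j x0 Xx0 => // j IH x0 Xx0 hj.
have [/existsNP [y /not_implyP [Xy /negP hy]]|hx] := EM (~ forall y, X y -> h x0 <= h y).
  apply: (IH y Xy); move: hy hj (hm _ Xy) (hm _ Xx0); lia.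
by exists x0 => //; apply: contrapT.
Qed.

Lemma extremes k (X : int * int -> Prop) (h : int * int -> int) x0 :
  X x0 -> diam_at_most k X -> (forall x y, h x - h y <= l1dist x y) ->
  exists2 x, X x & forall y, X y -> h x <= h y.
Proof.
move=> Xx0 Xk h1; apply: (@exists_min_int _ _ _ _ (h x0 - k%:Z) Xx0) => x Xx.
move: (h1 x0 x) (Xk _ _ Xx0 Xx); lia.
Qed.

(** In the coordinates [u = x + y], [v = x - y] the near centers are the lattice points of a
    nonempty box, and lattice points are the pairs with [u] and [v] of equal parity. A box without
    any is a single pair of the wrong parity, which forces each side of the bounding box to be 0, or
    2 with [k = 2]. *)
Lemma no_near_center k X x0 : (2 <= k)%N -> X x0 -> diam_at_most k X ->
  (forall w, ~ near_center k X w) ->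
  k = 2%N /\ exists q, (forall x, X x -> unit_square q x) /\ has_diagonal q X.
Proof.
move=> k2 Xx0 Xk noc.
have [a Xa ha] := @extremes k X (fun x => x.1 + x.2) _ Xx0 Xk
  ltac:(by move=> x y; rewrite /l1dist; lia).
have [a' Xa' ha'] := @extremes k X (fun x => - (x.1 + x.2)) _ Xx0 Xk
  ltac:(by move=> x y; rewrite /l1dist; lia).
have [b Xb hb] := @extremes k X (fun x => x.1 - x.2) _ Xx0 Xk
  ltac:(by move=> x y; rewrite /l1dist; lia).
have [b' Xb' hb'] := @extremes k X (fun x => x.2 - x.1) _ Xx0 Xk
  ltac:(by move=> x y; rewrite /l1dist; lia).
rewrite /= in ha ha' hb hb'.
have cand (w : int * int) : a.1 + a.2 <= w.1 + w.2 -> w.1 + w.2 <= a'.1 + a'.2 ->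
    b.1 - b.2 <= w.1 - w.2 -> w.1 - w.2 <= b'.1 - b'.2 ->
    a'.1 + a'.2 - w.1 - w.2 <= k%:Z - 1 -> w.1 + w.2 - a.1 - a.2 <= k%:Z - 1 ->
    b'.1 - b'.2 - w.1 + w.2 <= k%:Z - 1 -> w.1 - w.2 - b.1 + b.2 <= k%:Z - 1 -> False.
  move=> *; apply: (noc w); split.
    by split; [exists a|exists a'|exists b|exists b'] => //; lia.
  move=> s Xs; move: (ha s Xs) (ha' s Xs) (hb s Xs) (hb' s Xs); rewrite /l1dist /=; lia.
have eq_pt (x y : int * int) : X x -> x.1 = y.1 -> x.2 = y.2 -> X y.
  by case: x y => [x1 x2] [y1 y2] Xx /= <- <-.
have Pa := Xk _ _ Xa Xa'; have Pb := Xk _ _ Xb Xb'.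
rewrite /l1dist in Pa Pb.
have := ha' a Xa; have := hb' b Xb.
have := hb a Xa; have := hb' a Xa; have := hb a' Xa'; have := hb' a' Xa'.
have := ha b Xb; have := ha' b Xb; have := ha b' Xb'; have := ha' b' Xb'.
move=> B1 B2 B3 B4 A1 A2 A3 A4 BB AA.
have {}Pa : a'.1 + a'.2 - a.1 - a.2 <= k%:Z by lia.
have {}Pb : b'.1 - b'.2 - b.1 + b.2 <= k%:Z by lia.
(* [u0] is the least admissible value of [u]: one above the minimum when the range has length [k],
   the minimum itself otherwise. [v0] is chosen likewise. *)
have [u0 Hu0] : exists u0 : int,
    (a'.1 + a'.2 - a.1 - a.2 = k%:Z /\ u0 = a.1 + a.2 + 1) \/
    (a'.1 + a'.2 - a.1 - a.2 < k%:Z /\ u0 = a.1 + a.2).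
  by case: (ltrP (a'.1 + a'.2 - a.1 - a.2) k%:Z) => ?; eexists; [right|left]; split=> //; lia.
have [v0 Hv0] : exists v0 : int,
    (b'.1 - b'.2 - b.1 + b.2 = k%:Z /\ v0 = b.1 - b.2 + 1) \/
    (b'.1 - b'.2 - b.1 + b.2 < k%:Z /\ v0 = b.1 - b.2).
  by case: (ltrP (b'.1 - b'.2 - b.1 + b.2) k%:Z) => ?; eexists; [right|left]; split=> //; lia.
(* If [u0 + v0] is even, [(u0, v0)] comes from a lattice point, which is a near center. *)
pose x := ((u0 + v0) %/ 2)%Z.
have [ev|odd] : (2 * x = u0 + v0) \/ (2 * x = u0 + v0 - 1) by rewrite /x; lia.
  by exfalso; apply: (cand (x, u0 - x)) => /=; lia.
(* Raising [u0] or [v0] by 1 repairs the parity, so neither raised value can be admissible. *)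
have Hu : a'.1 + a'.2 = a.1 + a.2 \/ k = 2%N /\ a'.1 + a'.2 = a.1 + a.2 + 2.
  apply: contrapT => h; apply: (cand (x + 1, u0 - x)) => /=; lia.
have Hv : b'.1 - b'.2 = b.1 - b.2 \/ k = 2%N /\ b'.1 - b'.2 = b.1 - b.2 + 2.
  apply: contrapT => h; apply: (cand (x + 1, u0 - x - 1)) => /=; lia.
clear cand.
case: Hu => [Ea|[k2' Ea]].
(* If both ranges are trivial, [X] is one lattice point, against the odd parity. *)
- case: Hv => [Eb|[k2' Eb]]; first by exfalso; lia.
  split=> //; exists (b.1, b.2 - 1); split; last first.
    by right; split; [apply: (eq_pt b')|apply: (eq_pt b)] => //=; lia.
  move=> s Xs; rewrite /unit_square /=.
  by move: (ha s Xs) (ha' s Xs) (hb s Xs) (hb' s Xs); lia.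
split=> //; exists a; split.
  move=> s Xs; rewrite /unit_square /=.
  by move: (ha s Xs) (ha' s Xs) (hb s Xs) (hb' s Xs); lia.
by left; split; [|apply: (eq_pt a')] => //=; lia.
Qed.

(** A set without near center serves as its own core, so that a nonempty set always has a nonempty
    core. *)
Definition core (k : nat) (X : int * int -> Prop) (w : int * int) :=
  near_center k X w \/ ((forall w', ~ near_center k X w') /\ X w).

Lemma core_box_hull k X w : core k X w -> box_hull X w.
Proof. by case=> [[]//|[_]]; exact: sub_box_hull. Qed.

Lemma core_nonempty k (X : int * int -> Prop) x : X x -> exists w, core k X w.
Proof.
move=> Xx; have [[w Xw]|h] := EM (exists w, near_center k X w).
  by exists w; left.
by exists x; right; split=> // w Xw; apply: h; exists w.
Qed.

Lemma near_center_translate k (X Y : int * int -> Prop) (t : int * int) w :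
  (forall x, X x <-> Y (x.1 + t.1, x.2 + t.2)) ->
  near_center k X w -> near_center k Y (w.1 + t.1, w.2 + t.2).
Proof.
move=> XY [[[a /XY ? ?] [b /XY ? ?] [c /XY ? ?] [d /XY ? ?]] h]; split.
  by split; [exists (a.1 + t.1, a.2 + t.2)|exists (b.1 + t.1, b.2 + t.2)
    |exists (c.1 + t.1, c.2 + t.2)|exists (d.1 + t.1, d.2 + t.2)] => //=; lia.
move=> s Ys; have /h : X (s.1 - t.1, s.2 - t.2).
  by apply/XY => /=; rewrite !subrK; case: s Ys.
by rewrite /l1dist /=; lia.
Qed.

(** Makes the core of a vertex set of the torus independent of the lift, as lifts are translates of
    each other. *)
Lemma core_translate k (X Y : int * int -> Prop) (t : int * int) w :
  (forall x, X x <-> Y (x.1 + t.1, x.2 + t.2)) ->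
  core k X w -> core k Y (w.1 + t.1, w.2 + t.2).
Proof.
move=> XY [nX|[noX Xw]]; first by left; exact: near_center_translate XY nX.
right; split; last exact/XY.
move=> w' nY; have XY' y : Y y <-> X (y.1 + (- t.1, - t.2).1, y.2 + (- t.1, - t.2).2).
  by rewrite XY /= !subrK -surjective_pairing.
exact: noX (near_center_translate XY' nY).
Qed.

(** A near center is within 1 of both ends of the diagonal. Without near centers, [X] lies in some
    unit square, and the diagonal determines which one. *)
Lemma core_diagonal k X q w : diam_at_most k X -> k = 2%N ->
  has_diagonal q X -> (exists x, X x) -> core k X w -> unit_square q w.
Proof.
move=> Xk k2 dg [x0 Xx0] [[_ h]|[no Xw]].
  by case: dg => -[/h + /h]; rewrite /l1dist /unit_square /= k2; lia.
have [|_ [q' [sq' _]]] := no_near_center _ Xx0 Xk no; first by rewrite k2.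
by move: (sq' _ Xw); case: dg => -[/sq' + /sq']; rewrite /unit_square /=; lia.
Qed.

(** If some member [B] has no near center, smaller members have their bounding box in the unit
    square of [B], and larger ones contain its diagonal. Otherwise, for [X] inside [Y], a near
    center of [Y] is within [k - 1] of all of [X], hence of the bounding box of [X]. *)
Lemma core_chain k (C : (int * int -> Prop) -> Prop) : (2 <= k)%N ->
  (forall X, C X -> diam_at_most k X /\ exists x, X x) ->
  (forall X Y, C X -> C Y ->
     (forall x, X x -> Y x) \/ (forall x, Y x -> X x)) ->
  (forall v w, (exists2 X, C X & core k X v) -> (exists2 X, C X & core k X w) ->
     l1dist v w <= k%:Z - 1) \/
  exists q, forall w, (exists2 X, C X & core k X w) -> unit_square q w.
Proof.
move=> k2 Ck Cchain.
have [[B [CB noB]]|all_good] := EM (exists B, C B /\ forall w, ~ near_center k B w).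
  right; have [Bk [b Bb]] := Ck _ CB.
  have [k2' [q [Bq dB]]] := no_near_center k2 Bb Bk noB.
  exists q => w [X CX Xw]; have [Xk Xn0] := Ck _ CX.
  have [XB|BX] := Cchain _ _ CX CB.
    by apply: (box_hull_unit_square Bq); apply: box_hull_mono XB (core_box_hull Xw).
  apply: (core_diagonal Xk k2' _ Xn0 Xw).
  by case: dB => -[/BX ? /BX ?]; [left|right].
have good X w : C X -> core k X w -> near_center k X w.
  by move=> CX [//|[no _]]; case: all_good; exists X.
left => v w [X CX Xv] [Y CY Yw].
wlog XY : v w X Y CX CY Xv Yw / (forall x, X x -> Y x) => [hw|].
  have [XY|YX] := Cchain _ _ CX CY; first exact: (hw _ _ _ _ CX CY).
  by rewrite l1distC; exact: (hw _ _ _ _ CY CX).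
have [_ hY] := good _ _ CY Yw.
rewrite l1distC; apply: (l1dist_box_hull _ hY).
exact: box_hull_mono XY (core_box_hull Xv).
Qed.

(** * Lifting vertex sets of the torus to the plane *)

(** [l] is total but constrained on [S] only, so that it restricts to subsets unchanged. *)
Definition lift_on (n k : nat) (l : 'I_n * 'I_n -> int * int) (S : {set 'I_n * 'I_n}) :=
  (forall v, v \in S -> pi_eq (l v) v) /\
  (forall v w, v \in S -> w \in S -> l1dist (l v) (l w) <= k%:Z).

(** The common form of both complexes of the theorem: the images on the torus of the simplices of
    the planar Vietoris-Rips complex. *)
Definition rips_image (n k : nat) (S : {set 'I_n * 'I_n}) :=
  S != finset.set0 /\ exists l, @lift_on n k l S.

Lemma lift_onS (n k : nat) l (S T : {set 'I_n * 'I_n}) :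
  T \subset S -> lift_on k l S -> lift_on k l T.
Proof.
move=> /fintype.subsetP TS [h1 h2]; split; first by move=> v /TS /h1.
by move=> v w /TS vS /TS wS; exact: h2.
Qed.

Lemma rips_imageS (n k : nat) (S T : {set 'I_n * 'I_n}) :
  rips_image k S -> T \subset S -> T != finset.set0 -> rips_image k T.
Proof. by move=> [_ [l lS]] TS T0; split=> //; exists l; exact: lift_onS lS. Qed.

(** The working criterion for being a simplex; choosing a preimage in [X] of each vertex gives the
    lift. *)
Lemma rips_image_cover (n k : nat) (X : int * int -> Prop) (S : {set 'I_n * 'I_n}) :
  S != finset.set0 -> diam_at_most k X ->
  (forall v, v \in S -> exists2 x, X x & pi_eq x v) -> rips_image k S.
Proof.
move=> S0 Xk cov; split=> //.
have /choice [l hl] : forall v, exists x, v \in S -> X x /\ pi_eq x v.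
  move=> v; case: (boolP (v \in S)) => [/cov [x Xx xv]|_]; last by exists (0, 0).
  by exists x.
exists l; split; first by move=> v /hl [].
by move=> v w /hl [Xv _] /hl [Xw _]; exact: Xk.
Qed.

Lemma pi_eqE (n : nat) (v : 'I_n * 'I_n) x : pi_eq x v ->
  exists a b : int, x.1 = (v.1 : nat)%:Z + a * n%:Z /\ x.2 = (v.2 : nat)%:Z + b * n%:Z.
Proof.
move=> [h1 h2]; exists (x.1 %/ n)%Z, (x.2 %/ n)%Z.
by rewrite -h1 -h2; split; rewrite addrC -divz_eq.
Qed.

Lemma small_multiple (n : nat) (x c : int) : x = c * n%:Z -> `|x| < n%:Z -> x = 0.
Proof.
move=> ->; rewrite normrM; have [->|c0] := eqVneq c 0; first by rewrite mul0r.
have : 1 <= `|c| by lia.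
by move=> /(ler_wpM2r (ler0n int n)); lia.
Qed.

Lemma eq_modz (n : nat) (x y : int) (m : int) :
  modz x n%:Z = m -> modz y n%:Z = m -> `|x - y| < n%:Z -> x = y.
Proof.
move=> xm ym h; suff : x - y = 0 by lia.
apply: (small_multiple (c := (x %/ n)%Z - (y %/ n)%Z)) h.
by rewrite {1}(divz_eq x n%:Z) {1}(divz_eq y n%:Z) xm ym mulrBl; lia.
Qed.

Lemma pi_eq_inj (n : nat) (v : 'I_n * 'I_n) x y (m : nat) :
  pi_eq x v -> pi_eq y v -> l1dist x y <= m%:Z -> (m < n)%N -> x = y.
Proof.
case: x y => [x1 x2] [y1 y2] [/= x1v x2v] [/= y1v y2v]; rewrite /l1dist /= => h mn.
by congr (_, _); [apply: eq_modz x1v y1v _|apply: eq_modz x2v y2v _]; lia.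
Qed.

Lemma pi_eq_exists (n : nat) x : (0 < n)%N -> exists v : 'I_n * 'I_n, pi_eq x v.
Proof.
move=> n0; have P (y : int) : exists i : 'I_n, modz y n%:Z = (i : nat)%:Z.
  have h : (`|modz y n%:Z|%N < n)%N.
    by have := ltz_mod y (d := n%:Z); have := modz_ge0 y (d := n%:Z); lia.
  exists (Ordinal h) => /=; have := modz_ge0 y (d := n%:Z); lia.
by have [i hi] := P x.1; have [j hj] := P x.2; exists (i, j).
Qed.

Lemma pi_eq_diff (n : nat) (v w : 'I_n * 'I_n) x y x' y' :
  pi_eq x v -> pi_eq x' v -> pi_eq y w -> pi_eq y' w ->
  `|(y.1 - x.1) - (y'.1 - x'.1)| < n%:Z -> `|(y.2 - x.2) - (y'.2 - x'.2)| < n%:Z ->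
  y.1 - x.1 = y'.1 - x'.1 /\ y.2 - x.2 = y'.2 - x'.2.
Proof.
move=> xv x'v yw y'w h1 h2.
have [a [b [e1 e2]]] := pi_eqE xv; have [a' [b' [e7 e8]]] := pi_eqE x'v.
have [c [d [e3 e4]]] := pi_eqE yw; have [c' [d' [e5 e6]]] := pi_eqE y'w.
suff : y.1 - x.1 - (y'.1 - x'.1) = 0 /\ y.2 - x.2 - (y'.2 - x'.2) = 0 by lia.
split; [apply: (small_multiple (c := c - a - c' + a')) h1
  |apply: (small_multiple (c := d - b - d' + b')) h2].
  by rewrite e1 e3 e5 e7 !mulrDl !mulNr; lia.
by rewrite e2 e4 e6 e8 !mulrDl !mulNr; lia.
Qed.

(** The displacements from [v0] under the two lifts agree modulo [n] and differ by at most
    [2 * k < n] in each coordinate, so they are equal. *)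
Lemma lift_on_unique (n k : nat) l l' (S : {set 'I_n * 'I_n}) :
  (2 * k < n)%N -> lift_on k l S -> lift_on k l' S ->
  exists t : int * int, forall v, v \in S -> l' v = ((l v).1 + t.1, (l v).2 + t.2).
Proof.
move=> kn [l1 l2] [l'1 l'2]; case: (finset.set_0Vmem S) => [->|[v0 Sv0]].
  by exists (0, 0) => v; rewrite finset.inE.
exists ((l' v0).1 - (l v0).1, (l' v0).2 - (l v0).2) => v Sv.
have [] := pi_eq_diff (l1 _ Sv0) (l'1 _ Sv0) (l1 _ Sv) (l'1 _ Sv).
- have := l2 _ _ Sv0 Sv; have := l'2 _ _ Sv0 Sv; rewrite /l1dist; lia.
- have := l2 _ _ Sv0 Sv; have := l'2 _ _ Sv0 Sv; rewrite /l1dist; lia.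
move=> e1 e2; rewrite [LHS]surjective_pairing; congr (_, _) => /=; lia.
Qed.

(** * Torus distances, and comparison of the three complexes *)

Lemma cycdist_le (n a b : nat) (x y : int) : (a < n)%N -> (b < n)%N ->
  modz x n%:Z = a%:Z -> modz y n%:Z = b%:Z -> (cycdist n a b)%:Z <= `|x - y|.
Proof.
move=> an bn xa yb; rewrite /cycdist.
have := divz_eq x n%:Z; have := divz_eq y n%:Z; rewrite xa yb.
set p := (x %/ n)%Z; set q := (y %/ n)%Z => ye xe.
have xy : x - y = a%:Z - b%:Z + (p - q) * n%:Z by rewrite ye xe mulrBl; lia.
have [pq|pq] := eqVneq p q; first by move: xy; rewrite pq subrr mul0r; lia.
have : n%:Z <= `|(p - q) * n%:Z|.
  have : 1 <= `|p - q| by lia.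
  by move=> /(ler_wpM2r (ler0n int n)); rewrite normrM; lia.
lia.
Qed.

(** [y] is taken in the period of [x] if the direct arc is shortest, otherwise in the period before
    or after, according to the order of [a] and [b]. *)
Lemma cycdist_witness (n a b : nat) (x : int) : (a < n)%N -> (b < n)%N ->
  modz x n%:Z = a%:Z ->
  exists2 y, modz y n%:Z = b%:Z & `|x - y| = (cycdist n a b)%:Z.
Proof.
move=> an bn xa; rewrite /cycdist; have xe := divz_eq x n%:Z; rewrite xa in xe.
set p := (x %/ n)%Z in xe.
have mb : modz b%:Z n%:Z = b%:Z by rewrite modz_small //; lia.
have ok c : modz (c * n%:Z + b%:Z) n%:Z = b%:Z by rewrite modzMDl.
set d := (a - b + (b - a))%N.
have [dn|dn] := leqP d (n - d).
  by exists (p * n%:Z + b%:Z) => //; rewrite xe; move: dn; rewrite /d; clear -an bn; lia.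
have [ab|ab] := leqP a b.
  exists ((p - 1) * n%:Z + b%:Z); first exact: ok.
  by rewrite xe mulrBl mul1r; move: dn; rewrite /d; clear -an bn ab; lia.
exists ((p + 1) * n%:Z + b%:Z); first exact: ok.
by rewrite xe mulrDl mul1r; move: dn; rewrite /d; clear -an bn ab; lia.
Qed.

Lemma torus_dist_le (n : nat) (v w : 'I_n * 'I_n) x y :
  pi_eq x v -> pi_eq y w -> (torus_dist v w)%:Z <= l1dist x y.
Proof.
move=> [x1 x2] [y1 y2]; rewrite /torus_dist /l1dist PoszD.
by apply: lerD; apply: cycdist_le => //; exact: ltn_ord.
Qed.

Lemma torus_dist_witness (n : nat) (v w : 'I_n * 'I_n) x :
  pi_eq x v -> exists2 y, pi_eq y w & l1dist x y = (torus_dist v w)%:Z.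
Proof.
move=> [x1 x2].
have [y1 ? e1] := cycdist_witness (ltn_ord v.1) (ltn_ord w.1) x1.
have [y2 ? e2] := cycdist_witness (ltn_ord v.2) (ltn_ord w.2) x2.
by exists (y1, y2); rewrite ?/l1dist //= e1 e2.
Qed.

(** Lift every vertex as close as possible to a fixed lift of [v0]. A lift [y] of [w] closest to
    [l v] is then within [3 * k < n] of [l w], by way of [l v] and the lift of [v0], so it equals
    [l w]. *)
Lemma VR_torusE (n k : nat) (S : {set 'I_n * 'I_n}) :
  (3 * k < n)%N -> VR_torus k S <-> rips_image k S.
Proof.
move=> kn; split=> -[S0 H]; split=> //; last first.
  case: H => l [l1 l2] v w vS wS.
  have := torus_dist_le (l1 _ vS) (l1 _ wS); have := l2 _ _ vS wS; lia.
have /finset.set0Pn [v0 v0S] := S0.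
have b0 : pi_eq ((v0.1 : nat)%:Z, (v0.2 : nat)%:Z) v0.
  by split; rewrite /= modz_small // ltz_nat ltn_ord.
have /choice [l hl] : forall v, exists y, pi_eq y v /\
    l1dist ((v0.1 : nat)%:Z, (v0.2 : nat)%:Z) y = (torus_dist v0 v)%:Z.
  by move=> v; have [y] := torus_dist_witness v b0; exists y.
exists l; split=> [v _|v w vS wS]; first by have [] := hl v.
have [lv dv] := hl v; have [lw dw] := hl w.
have [y yw dy] := torus_dist_witness w lv.
have hv := H _ _ v0S vS; have hw := H _ _ v0S wS; have hvw := H _ _ vS wS.
suff -> : l w = y by rewrite dy; lia.
apply: (pi_eq_inj (m := (3 * k)%N) lw yw) => //.
by move: dv dw dy; rewrite /l1dist /=; lia.
Qed.

(** Greedy extension: scan a finite box holding all points within [k] of [x0], and keep each point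
    that respects the diameter bound. *)
Lemma VRZ2_extend (k : nat) (s0 : seq (int * int)) : VRZ2_simplex k s0 ->
  exists2 s, VRZ2_maximal k s & {subset s0 <= s}.
Proof.
move=> [s0_0 s0k]; have [x0 x0s] : exists x0 : int * int, x0 \in s0.
  by case: s0 s0_0 {s0k} => // x s _; exists x; rewrite inE eqxx.
pose add s y := if all (fun x => l1dist x y <= k%:Z) s then y :: s else s.
have addS (B s : seq (int * int)) : {subset s <= foldl add s B}.
  elim: B s => [|y B IH] s //= x xs; apply: IH.
  by rewrite /add; case: ifP => // _; rewrite inE xs orbT.
have addk B s : diam_le k s -> diam_le k (foldl add s B).
  elim: B s => [|y B IH] s //= sk; apply: IH; rewrite /add; case: ifP => // /allP h.
  move=> a b; rewrite !inE => /predU1P [->|a_s] /predU1P [->|b_s].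
  - by rewrite /l1dist; lia.
  - by rewrite l1distC; exact: h.
  - exact: h.
  - exact: sk.
(* When [y] is scanned, the current list is contained in the final one, hence in [t], so [y] passes
   the test. *)
have addM (B s : seq (int * int)) (y : int * int) (t : seq (int * int)) :
    y \in B -> y \in t -> diam_le k t ->
    {subset foldl add s B <= t} -> y \in foldl add s B.
  elim: B s => [|z B IH] s //=; rewrite inE => /predU1P [->|yB] yt tk st; last exact: IH.
  apply: (addS); rewrite /add ifT ?inE ?eqxx //; apply/allP => x xs; apply: tk => //.
  by apply: st; apply: (addS); rewrite /add; case: ifP => // _; rewrite inE xs orbT.
pose r : seq int := [seq (i : nat)%:Z - k%:Z | i <- iota 0 (2 * k).+1].
pose B : seq (int * int) := [seq (x0.1 + i, x0.2 + j) | i <- r, j <- r].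
have rP (i : int) : - k%:Z <= i <= k%:Z -> i \in r.
  move=> hi; apply/mapP; exists (absz (i + k%:Z)); first by rewrite mem_iota; lia.
  by lia.
exists (foldl add s0 B); last exact: addS.
split; first split; [|exact: addk|].
  by apply/eqP => e; have := addS B _ _ x0s; rewrite e.
move=> t [_ tk] st y yt; apply: (addM _ _ _ t) => //.
have := tk _ _ (st _ (addS B _ _ x0s)) yt; rewrite /l1dist => hy.
apply/allpairsP; exists (y.1 - x0.1, y.2 - x0.2) => /=; split; try (by apply: rP; lia).
by rewrite !(addrC x0.1) !(addrC x0.2) !subrK -surjective_pairing.
Qed.

Lemma K_complexE (n k : nat) (S : {set 'I_n * 'I_n}) :
  K_complex k S <-> rips_image k S.
Proof.
split=> [[S0 [T [s [[[_ sk] _] sT]] ST]]|[S0 [l [l1 l2]]]].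
  apply: (rips_image_cover (X := fun x => x \in s)) => //.
  by move=> v /(fintype.subsetP ST) /sT.
split=> //; have [|s smax s0s] := @VRZ2_extend k [seq l v | v <- enum S].
  split; last first.
    move=> x y /mapP [v]; rewrite mem_enum => vS -> /mapP [w].
    by rewrite mem_enum => wS ->; exact: l2.
  have /finset.set0Pn [v vS] := S0.
  by apply/eqP => /(congr1 (fun s => l v \in s)); rewrite map_f ?mem_enum.
exists (finset.finset (fun v => `[< exists2 x, x \in s & pi_eq x v >])).
  by exists s; split=> // v; rewrite finset.inE; by split=> /asboolP.
apply/fintype.subsetP => v vS; rewrite finset.inE; apply/asboolP.
by exists (l v); [apply: s0s; rewrite map_f ?mem_enum|exact: l1].
Qed.

(** * Cores of vertex sets of the torus *)

Definition lift_image (n : nat) (l : 'I_n * 'I_n -> int * int)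
    (S : {set 'I_n * 'I_n}) (y : int * int) :=
  exists2 v, v \in S & y = l v.

Definition core_vertex (n k : nat) (S : {set 'I_n * 'I_n}) (w : 'I_n * 'I_n) :=
  exists2 l, lift_on k l S & exists2 x, pi_eq x w & core k (lift_image l S) x.

Lemma core_vertex_lift (n k : nat) l0 (S0 S : {set 'I_n * 'I_n}) w :
  (2 * k < n)%N -> lift_on k l0 S0 -> S \subset S0 -> core_vertex k S w ->
  exists2 x, pi_eq x w & core k (lift_image l0 S) x.
Proof.
move=> kn l0S0 SS0 [l lS [x xw cx]].
have l0S := lift_onS SS0 l0S0.
have [S_0|[v0 v0S]] := finset.set_0Vmem S.
  by have [[s [v vS _] _] _ _ _] := core_box_hull cx; rewrite S_0 finset.inE in vS.
have [t ht] := lift_on_unique kn lS l0S.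
(* Both lifts of [v0] lie over [v0], so the translation is by multiples of [n] and the translated
   point still lies over [w]. *)
have [a [b [ta tb]]] : exists a b, t.1 = a * n%:Z /\ t.2 = b * n%:Z.
  have [a [b [e1 e2]]] := pi_eqE (lS.1 _ v0S).
  have [a' [b' [e1' e2']]] := pi_eqE (l0S.1 _ v0S).
  exists (a' - a), (b' - b); move: e1 e2 e1' e2'; rewrite (ht _ v0S) /= !mulrBl; lia.
exists (x.1 + t.1, x.2 + t.2).
  by case: xw => x1 x2; split; rewrite /= ?ta ?tb addrC modzMDl.
apply: core_translate cx => y; split=> -[v vS yE]; exists v => //.
  by rewrite ht // yE.
move: yE; rewrite ht // => -[] /addIr e1 /addIr e2.
by rewrite (surjective_pairing y) e1 e2 -surjective_pairing.
Qed.

Lemma core_vertex_simplex (n k : nat) (S : {set 'I_n * 'I_n}) w :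
  core_vertex k S w -> S != finset.set0.
Proof.
move=> [l lS [x xw cx]]; apply/finset.set0Pn.
by have [[s [v vS _] _] _ _ _] := core_box_hull cx; exists v.
Qed.

Lemma core_vertex_exists (n k : nat) (S : {set 'I_n * 'I_n}) :
  (0 < n)%N -> rips_image k S -> exists w, core_vertex k S w.
Proof.
move=> n0 [/finset.set0Pn [v vS] [l lS]].
have [x cx] := @core_nonempty k (lift_image l S) (l v) ltac:(by exists v).
by have [w xw] := pi_eq_exists x n0; exists w, l => //; exists x.
Qed.

(** The cores of all members of the chain are lifted along the single lift [l0], so that
    [core_chain] can compare them in the plane. *)
Lemma core_lift (n k : nat) l0 (S0 A : {set 'I_n * 'I_n})
    (C : {set 'I_n * 'I_n} -> Prop) :
  (2 <= k)%N -> (2 * k < n)%N -> lift_on k l0 S0 ->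
  (forall S, C S -> S \subset S0) ->
  (forall S T, C S -> C T -> S \subset T \/ T \subset S) ->
  (forall w, w \in A -> exists2 S, C S & core_vertex k S w) ->
  exists l, [/\ forall w, w \in A -> pi_eq (l w) w,
    forall w, w \in A -> box_hull (lift_image l0 S0) (l w) &
    (forall v w, v \in A -> w \in A -> l1dist (l v) (l w) <= k%:Z - 1) \/
    exists q, forall w, w \in A -> unit_square q (l w)].
Proof.
move=> k2 kn l0S0 CS0 Cchain CA.
have /choice [l hl] : forall w, exists x, w \in A ->
    pi_eq x w /\ exists2 S, C S /\ S != finset.set0 & core k (lift_image l0 S) x.
  move=> w; case: (boolP (w \in A)) => [/CA [S CS cS]|_]; last by exists (0, 0).
  have [x xw cx] := core_vertex_lift kn l0S0 (CS0 _ CS) cS.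
  by exists x => _; split=> //; exists S => //; split=> //; exact: core_vertex_simplex cS.
have mono (S T : {set 'I_n * 'I_n}) : S \subset T ->
    forall x, lift_image l0 S x -> lift_image l0 T x.
  by move=> /fintype.subsetP ST x [v /ST vT ->]; exists v.
pose D X := exists2 S, C S /\ S != finset.set0 & X = lift_image l0 S.
have Dl w : w \in A -> exists2 X, D X & core k X (l w).
  by move=> /hl [_ [S CS cS]]; exists (lift_image l0 S) => //; exists S.
exists l; split; first by move=> w /hl [].
  move=> w /hl [_ [S [CS _] /core_box_hull]]; apply: box_hull_mono.
  exact: mono (CS0 _ CS).
have [||h|[q h]] := @core_chain k D k2.
- move=> _ [S [CS /finset.set0Pn [v vS]] ->]; split; last by exists (l0 v), v.
  by move=> x y [a aS ->] [b bS ->]; apply: (lift_onS (CS0 _ CS) l0S0).2.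
- move=> _ _ [S [CS _] ->] [T [CT _] ->].
  by have [ST|TS] := Cchain _ _ CS CT; [left|right]; exact: mono.
- by left => v w /Dl ? /Dl ?; exact: h.
- by right; exists q => w /Dl; exact: h.
Qed.

(** * Periodic parametrization of the circle *)

(** Period [n] puts the vertices of the cycle at integer parameters. *)
Definition cosn (R : realType) (n : nat) (z : R) : R := cos (pi *+ 2 * (z / n%:R)).
Definition sinn (R : realType) (n : nat) (z : R) : R := sin (pi *+ 2 * (z / n%:R)).

Lemma periodic_int (R : realType) (f : R -> R) (T x : R) (m : int) :
  periodic f T -> f (x + T *~ m) = f x.
Proof.
move=> fT; case: m => [m|m]; first by rewrite -pmulrn periodicn.
by rewrite NegzE mulrNz -pmulrn -[in RHS](subrK (T *+ m.+1) x) periodicn.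
Qed.

Lemma cosn_periodic (R : realType) (n : nat) (z : R) (m : int) : (0 < n)%N ->
  cosn n (z + m%:~R * n%:R) = cosn n z.
Proof.
move=> n0; rewrite /cosn [(z + _) / _]mulrDl mulfK ?pnatr_eq0 -?lt0n // mulrDr mulrzr.
by rewrite periodic_int //; exact: cosD2pi.
Qed.

Lemma sinn_periodic (R : realType) (n : nat) (z : R) (m : int) : (0 < n)%N ->
  sinn n (z + m%:~R * n%:R) = sinn n z.
Proof.
move=> n0; rewrite /sinn [(z + _) / _]mulrDl mulfK ?pnatr_eq0 -?lt0n // mulrDr mulrzr.
by rewrite periodic_int //; exact: sinD2pi.
Qed.

Lemma cosnB (R : realType) (n : nat) (x y : R) :
  cosn n (x - y) = cosn n x * cosn n y + sinn n x * sinn n y.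
Proof. by rewrite /cosn mulrBl mulrBr cosB. Qed.

Lemma cosn2Dsinn2 (R : realType) (n : nat) (x : R) : cosn n x ^+ 2 + sinn n x ^+ 2 = 1.
Proof. exact: cos2Dsin2. Qed.

Lemma circle_param (R : realType) (n : nat) (x y : R) : (0 < n)%N ->
  x ^+ 2 + y ^+ 2 = 1 -> exists z, x = cosn n z /\ y = sinn n z.
Proof.
move=> n0 xy; have x1 : -1 <= x <= 1 by nra.
suff [a [-> ->]] : exists a, x = cos a /\ y = sin a.
  exists (a / (pi *+ 2) * n%:R); rewrite /cosn /sinn mulfK ?pnatr_eq0 -?lt0n //.
  by rewrite mulrCA divff ?mulr1 // mulrn_eq0 /= gt_eqF // pi_gt0.
have sq : 1 - x ^+ 2 = y ^+ 2 by rewrite -xy addrC addKr.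
have [y0|y0] := leP 0 y.
  by exists (acos x); rewrite acosK ?sin_acos // sq sqrtr_sqr ger0_norm.
exists (- acos x); rewrite cosN sinN acosK ?sin_acos // sq sqrtr_sqr ler0_norm ?opprK //.
exact: ltW.
Qed.

Lemma cosn_gt (R : realType) (n : nat) (s t : R) : (0 < n)%N ->
  `|t| <= n%:R / 2 -> `|s| <= n%:R / 2 -> (cosn n s < cosn n t) = (`|t| < `|s|).
Proof.
move=> n0 ht hs; have nR : 0 < n%:R :> R by rewrite ltr0n.
have pi0 := pi_gt0 R.
have normE (x : R) : `|pi *+ 2 * (x / n%:R)| = pi *+ 2 / n%:R * `|x|.
  rewrite normrM normf_div (ger0_norm (ltW nR)) ger0_norm; last by rewrite mulrn_wge0 ?ltW.
  by rewrite mulrCA mulrC.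
have cosnE (y : R) : cosn n y = cos (pi *+ 2 / n%:R * `|y|).
  by rewrite -normE cos_norm.
rewrite !cosnE.
have c0 : 0 < pi *+ 2 / n%:R :> R by rewrite divr_gt0 // pmulrn_rgt0.
have bound (x : R) : `|x| <= n%:R / 2 -> pi *+ 2 / n%:R * `|x| \in `[0, pi]%R.
  move=> hx; rewrite in_itv /= mulr_ge0 ?(ltW c0) //=.
  apply: le_trans (ler_wpM2l (ltW c0) hx) _.
  by rewrite mulrA divfK ?gt_eqF // -[pi *+ 2]mulr_natr mulfK.
by rewrite ltr_cos ?bound // ltr_pM2l.
Qed.

Lemma cosn_gt_near (R : realType) (n : nat) (t : R) : (2 <= n)%N ->
  cosn n 1 < cosn n t -> exists m : int, `|t + m%:~R * n%:R| < 1.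
Proof.
move=> n2; have n0 : (0 < n)%N by lia.
have nR : 2 <= n%:R :> R by rewrite ler_nat.
(* The integer nearest to [t / n]: subtracting [m] periods brings [t] within half a period of 0,
   where [cosn_gt] applies. *)
pose m := Num.floor (t / n%:R + 2^-1).
have /andP [m1 m2] := floor_itv (t / n%:R + 2^-1).
rewrite -(cosn_periodic t (- m) n0) cosn_gt //.
- by rewrite normr1; exists (- m).
- rewrite ler_norml; move: m1 m2; rewrite -/m => m1 m2.
  have tE : t = t / n%:R * n%:R by rewrite divfK // pnatr_eq0 -lt0n.
  have n0' : 0 <= n%:R :> R by [].
  have := ler_wpM2r n0' m1; have := ler_wpM2r n0' (ltW m2).
  rewrite intrD !mulrDl -tE rmorphN /= mulNr mul1r.
  by lra.
- by rewrite normr1; lra.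
Qed.

Lemma near_cosn_gt (R : realType) (n : nat) (t : R) : (2 <= n)%N ->
  `|t| < 1 -> cosn n 1 < cosn n t.
Proof.
move=> n2 t1; have nR : 2 <= n%:R :> R by rewrite ler_nat.
rewrite cosn_gt ?normr1 //; first by lia.
  by apply: le_trans (ltW t1) _; lra.
by lra.
Qed.

(** * Continuity and straight-line homotopies *)

Import numFieldNormedType.Exports.

Local Notation R := Rdefinitions.R.
Local Open Scope classical_set_scope.
Local Open Scope ring_scope.

Lemma cont_map_at (X Y : topologicalType) (A : set X) (B : set Y) (f : X -> Y) :
  (forall x, A x -> {for x, continuous f}) -> (forall x, A x -> B (f x)) ->
  cont_map A B f.
Proof.
by move=> fc fAB; split=> //; apply: continuous_in_subspaceT => x; rewrite inE => /fc.
Qed.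

Lemma continuous_ptws (K : realType) (X : topologicalType) (V : choiceType) (x : X)
    (f : X -> {ptws V -> K}) :
  (forall v, {for x, continuous (fun y => f y v)}) -> {for x, continuous f}.
Proof.
move=> fc; rewrite /prop_for /continuous_at.
apply/(@cvg_sup _ V (fun v => Topological.class (initial_topology (fun g : V -> K => g v)))) => v.
move=> A [B [[C oC <-] Cfx BA]].
have nC : nbhs (f x v) C by apply: open_nbhs_nbhs.
have h : nbhs x ((fun y => f y v) @^-1` C) by exact: (fc v C nC).
rewrite /= nbhs_simpl /=; apply: filterS h => y Cy; exact: (BA (f y) Cy).
Qed.

Lemma continuous_coord (K : realType) (V : choiceType) (v : V) (f : {ptws V -> K}) :
  {for f, continuous (fun g : {ptws V -> K} => g v : K)}.
Proof. exact: (@proj_continuous V (fun=> K) v f). Qed.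

Section pointwise_continuity.
Context (K : realType) (X : topologicalType) (x : X).
Implicit Types f g : X -> K.

Lemma continuous_sum_at (I : finType) (P : pred I) (F : I -> X -> K) :
  (forall i, {for x, continuous (F i)}) ->
  {for x, continuous (fun y => \sum_(i | P i) F i y)}.
Proof.
move=> Fc; rewrite /prop_for /continuous_at; apply: cvg_big => [|i _]; last exact: Fc.
exact: (@add_continuous K^o).
Qed.

Lemma continuous_prod_at (I : finType) (P : pred I) (F : I -> X -> K) :
  (forall i, {for x, continuous (F i)}) ->
  {for x, continuous (fun y => \prod_(i | P i) F i y)}.
Proof.
move=> Fc; rewrite /prop_for /continuous_at; apply: cvg_big => [|i _]; last exact: Fc.
exact: (@mul_continuous K).
Qed.

Lemma continuous_max0_at f : {for x, continuous f} ->
  {for x, continuous (fun y => Num.max 0 (f y))}.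
Proof. by move=> fc; apply: (@continuous_max K X (fun=> 0)) => //; exact: cst_continuous. Qed.

Lemma continuousD_at f g : {for x, continuous f} -> {for x, continuous g} ->
  {for x, continuous (fun y => f y + g y)}.
Proof. exact: (@continuousD K K^o). Qed.

Lemma continuousB_at f g : {for x, continuous f} -> {for x, continuous g} ->
  {for x, continuous (fun y => f y - g y)}.
Proof. exact: (@continuousB K K^o). Qed.

Lemma continuousM_at f g : {for x, continuous f} -> {for x, continuous g} ->
  {for x, continuous (fun y => f y * g y)}.
Proof. exact: continuousM. Qed.

Lemma continuous_div_at f g : {for x, continuous f} -> {for x, continuous g} ->
  g x != 0 -> {for x, continuous (fun y => f y / g y)}.
Proof.
move=> fc gc g0; apply: continuousM_at => //.
by apply: continuous_comp => //; exact: inv_continuous.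
Qed.

Lemma continuous_compR_at (h : K -> K) f : continuous h -> {for x, continuous f} ->
  {for x, continuous (fun y => h (f y))}.
Proof. by move=> hc fc; apply: continuous_comp => //; exact: hc. Qed.

End pointwise_continuity.

Lemma continuous_pair_at (X Y Z : topologicalType) (x : X) (f : X -> Y) (g : X -> Z) :
  {for x, continuous f} -> {for x, continuous g} ->
  {for x, continuous (fun y => (f y, g y))}.
Proof. by move=> fc gc; apply: cvg_pair. Qed.

(** * Normalized weights and contiguous maps *)

Definition supp (V : finType) (f : V -> R) : {set V} := [set v | f v != 0]%SET.

Lemma supp0 (V : finType) (f : V -> R) v : (v \notin supp f) = (f v == 0).
Proof. by rewrite finset.inE negbK. Qed.

Definition normalize (V : finType) (m : V -> R) : {ptws V -> R} :=
  fun v => m v / \sum_w m w.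

Lemma supp_normalize (V : finType) (m : V -> R) : 0 < \sum_w m w ->
  supp (normalize m) = supp m.
Proof.
move=> m0; apply/finset.setP => v; rewrite !finset.inE /normalize.
by rewrite mulf_eq0 invr_eq0 (gt_eqF m0) orbF.
Qed.

Lemma sum_gt0 (V : finType) (m : V -> R) v : (forall w, 0 <= m w) -> 0 < m v ->
  0 < \sum_w m w.
Proof. by move=> m0 mv; rewrite (bigD1 v) //= ltr_wpDr // sumr_ge0. Qed.

Lemma realization_normalize (V : finType) (K : {set V} -> Prop) (m : V -> R) :
  (forall v, 0 <= m v) -> 0 < \sum_w m w -> K (supp m) ->
  realization K (normalize m).
Proof.
move=> m0 sm Km; split; first by move=> v; rewrite divr_ge0 // ltW.
by split; [rewrite -mulr_suml divff // gt_eqF|rewrite -supp_normalize in Km].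
Qed.

Lemma continuous_normalize (V : finType) (X : topologicalType) (x : X)
    (m : X -> V -> R) :
  (forall v, {for x, continuous (fun y => m y v)}) -> \sum_w m x w != 0 ->
  {for x, continuous (fun y => normalize (m y))}.
Proof.
move=> mc m0; apply: continuous_ptws => v.
by apply: continuous_div_at => //; exact: continuous_sum_at.
Qed.

Lemma supp_nonempty (V : finType) (f : V -> R) : \sum_v f v = 1 -> supp f != finset.set0.
Proof.
move=> f1; apply/eqP => s0; have := oner_neq0 R; rewrite -f1 big1 ?eqxx // => v _.
by apply/eqP; rewrite -supp0 s0 finset.inE.
Qed.

(** At most two of the points carry weight, and the support of the combination lies in the union of
    their supports. *)
Lemma realization_combination (V : finType) (K : {set V} -> Prop) (a b c : V -> R)
    (r s t : R) :
  (forall S T : {set V}, K S -> T \subset S -> T != finset.set0 -> K T) ->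
  (forall v, 0 <= a v) -> (forall v, 0 <= b v) -> (forall v, 0 <= c v) ->
  \sum_v a v = 1 -> \sum_v b v = 1 -> \sum_v c v = 1 ->
  0 <= r -> 0 <= s -> 0 <= t -> r + s + t = 1 ->
  (t = 0 /\ K (supp a :|: supp b)%SET) \/ (r = 0 /\ K (supp b :|: supp c)%SET) ->
  realization K (fun v => r * a v + s * b v + t * c v).
Proof.
move=> Kd a0 b0 c0 a1 b1 c1 r0 s0 t0 rst H.
have sum1 : \sum_v (r * a v + s * b v + t * c v) = 1.
  by rewrite !big_split /= -!mulr_sumr a1 b1 c1 !mulr1.
split; first by move=> v; rewrite !addr_ge0 // mulr_ge0.
split=> //; rewrite -/(supp (fun v => r * a v + s * b v + t * c v)).
case: H => -[z0]; move/Kd; apply; rewrite ?supp_nonempty //;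
  apply/fintype.subsetP => v; apply: contraTT; rewrite finset.inE negb_or !supp0.
  by move=> /andP [/eqP -> /eqP ->]; rewrite z0 !mulr0 mul0r !addr0.
by move=> /andP [/eqP -> /eqP ->]; rewrite z0 !mulr0 mul0r !addr0.
Qed.

(* Piecewise linear through [b]: each half moves inside single simplices. *)
Lemma homotopic_contiguous (V : finType) (K : {set V} -> Prop)
    (X : topologicalType) (A : set X) (a b c : X -> {ptws V -> R}) :
  (forall S T : {set V}, K S -> T \subset S -> T != finset.set0 -> K T) ->
  (forall x, A x -> {for x, continuous a}) ->
  (forall x, A x -> {for x, continuous b}) ->
  (forall x, A x -> {for x, continuous c}) ->
  (forall x, A x -> realization K (a x)) ->
  (forall x, A x -> realization K (b x)) ->
  (forall x, A x -> realization K (c x)) ->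
  (forall x, A x -> K (supp (a x) :|: supp (b x))%SET) ->
  (forall x, A x -> K (supp (b x) :|: supp (c x))%SET) ->
  homotopic A (realization K) a c.
Proof.
move=> Kd ac bc cc aK bK cK abK bcK.
(* [r] vanishes from time 1/2 on and [u] until time 1/2. *)
pose r (t : R) := Num.max 0 (1 - 2 * t); pose u (t : R) := Num.max 0 (2 * t - 1).
pose H (p : R * X) : {ptws V -> R} := fun v =>
  r p.1 * a p.2 v + (1 - r p.1 - u p.1) * b p.2 v + u p.1 * c p.2 v.
exists H; split; [apply: cont_map_at|split].
- move=> [t x] [/= _ Ax].
  have tc : {for (t, x), continuous (fun p : R * X => p.1)} by exact: cvg_fst.
  have cst (k : R) : {for (t, x), continuous (fun p : R * X => k)} by exact: cst_continuous.
  have rc : {for (t, x), continuous (fun p : R * X => r p.1)}.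
    by apply: continuous_max0_at; apply: continuousB_at => //; exact: continuousM_at.
  have uc : {for (t, x), continuous (fun p : R * X => u p.1)}.
    by apply: continuous_max0_at; apply: continuousB_at => //; exact: continuousM_at.
  have coord (f : X -> {ptws V -> R}) v : {for x, continuous f} ->
      {for (t, x), continuous (fun p : R * X => f p.2 v)}.
    move=> fc; apply: (@continuous_comp _ _ _ snd (fun y => f y v)).
      exact: cvg_snd.
    apply: (@continuous_comp _ _ _ f (fun g : {ptws V -> R} => g v)) => //.
    exact: continuous_coord.
  apply: continuous_ptws => v.
  apply: continuousD_at; [apply: continuousD_at|]; apply: continuousM_at => //.
  + by apply: coord; exact: ac.
  + by apply: continuousB_at => //; exact: continuousB_at.
  + by apply: coord; exact: bc.
  + by apply: coord; exact: cc.
(* The time interval in [homotopic] is stated with the order of the Stdlib reals. *)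
- move=> [t x] [/= [/RleP t0 /RleP t1] Ax].
  have {}t0 : 0 <= t := t0; have {}t1 : t <= 1 := t1.
  have [? [? _]] := aK x Ax; have [? [? _]] := bK x Ax; have [? [? _]] := cK x Ax.
  have [h|h] := lerP (2 * t) 1.
    have rE : r t = 1 - 2 * t by rewrite /r max_r //; lra.
    have uE : u t = 0 by rewrite /u max_l //; lra.
    rewrite /H /= rE uE; apply: realization_combination => //; try lra.
    by left; split=> //; exact: abK.
  have rE : r t = 0 by rewrite /r max_l //; lra.
  have uE : u t = 2 * t - 1 by rewrite /u max_r //; lra.
  rewrite /H /= rE uE; apply: realization_combination => //; try lra.
  by right; split=> //; exact: bcK.
- have r0 : r 0 = 1 by rewrite /r max_r //; lra.
  have u0 : u 0 = 0 by rewrite /u max_l //; lra.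
  move=> x Ax; change (H (0, x) = a x); apply/funext => v; rewrite /H /= r0 u0.
  by rewrite subr0 subrr mul1r !mul0r !addr0.
- have r1 : r 1 = 0 by rewrite /r max_l //; lra.
  have u1 : u 1 = 1 by rewrite /u max_r //; lra.
  move=> x Ax; change (H (1, x) = c x); apply/funext => v; rewrite /H /= r1 u1.
  by rewrite subr0 subrr mul1r !mul0r !add0r.
Qed.

(** * Shrinking a point of the complex *)

(* Positive exactly when [S] is a superlevel set of [p] inside its support, so
   the sets of positive weight form a chain, as in barycentric subdivision. *)
Definition level_weight (V : finType) (S : {set V}) (p : V -> R) :=
  (\prod_(v in S) p v) * \prod_(v in S) \prod_(w | w \notin S) Num.max 0 (p v - p w).

Lemma level_weight_ge0 (V : finType) (S : {set V}) (p : V -> R) :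
  (forall v, 0 <= p v) -> 0 <= level_weight S p.
Proof.
move=> p0; rewrite mulr_ge0 ?prodr_ge0 // => v _; rewrite prodr_ge0 // => w _.
by rewrite le_max lexx.
Qed.

Lemma level_weight_neq0 (V : finType) (S : {set V}) (p : V -> R) v :
  level_weight S p != 0 -> v \in S -> p v != 0 /\ forall w, w \notin S -> p w < p v.
Proof.
rewrite mulf_eq0 negb_or => /andP [/prodf_neq0 h1 /prodf_neq0 h2] vS.
split; first exact: h1.
move=> w wS; have /prodf_neq0 /(_ w wS) := h2 v vS.
by rewrite -subr_gt0 ltNge; apply: contra => h; rewrite max_l.
Qed.

Lemma level_weight_sub (V : finType) (S : {set V}) (p : V -> R) :
  level_weight S p != 0 -> S \subset supp p.
Proof.
move=> wS; apply/fintype.subsetP => v vS.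
by have [? _] := level_weight_neq0 wS vS; rewrite finset.inE.
Qed.

Lemma level_weight_chain (V : finType) (S T : {set V}) (p : V -> R) :
  level_weight S p != 0 -> level_weight T p != 0 -> S \subset T \/ T \subset S.
Proof.
move=> wS wT; have [ST|/fintype.subsetPn [v vS vT]] := boolP (S \subset T); first by left.
right; apply/fintype.subsetP => w wT'; apply: contraT => wS'.
have := (level_weight_neq0 wS vS).2 w wS'; have := (level_weight_neq0 wT wT').2 v vT.
by move=> h /(lt_trans h); rewrite ltxx.
Qed.

(** The support is itself a superlevel set; this keeps the total weight of [shrink] positive. *)
Lemma level_weight_supp (V : finType) (p : V -> R) :
  (forall v, 0 <= p v) -> 0 < level_weight (supp p) p.
Proof.
move=> p0; have pos v : v \in supp p -> 0 < p v.
  by rewrite finset.inE lt_neqAle eq_sym p0 andbT.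
rewrite mulr_gt0 ?prodr_gt0 // => v vS; rewrite prodr_gt0 // => w.
by rewrite supp0 => /eqP ->; rewrite subr0 lt_max pos ?orbT.
Qed.

Lemma continuous_level_weight (V : finType) (S : {set V}) (p : {ptws V -> R}) :
  {for p, continuous (fun p' : {ptws V -> R} => level_weight S p')}.
Proof.
apply: continuousM_at; apply: continuous_prod_at => v; first exact: continuous_coord.
apply: continuous_prod_at => w; apply: continuous_max0_at.
by apply: continuousB_at; exact: continuous_coord.
Qed.

Section shrink.
Context (n k : nat).
Implicit Types p : {ptws 'I_n * 'I_n -> R}.

(** Each vertex set passes its level weight on to all its core vertices. The range of the sum does
    not depend on [p], which gives continuity despite the case distinction in [core]. *)
Definition shrink_weight p (w : 'I_n * 'I_n) :=
  \sum_(S : {set 'I_n * 'I_n} | `[< core_vertex k S w >]) level_weight S p.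

Definition shrink p : {ptws 'I_n * 'I_n -> R} := normalize (shrink_weight p).

Lemma shrink_weight_ge0 p w : (forall v, 0 <= p v) -> 0 <= shrink_weight p w.
Proof. by move=> p0; rewrite sumr_ge0 // => S _; exact: level_weight_ge0. Qed.

Lemma shrink_weight_sum_gt0 p : (0 < n)%N -> realization (@rips_image n k) p ->
  0 < \sum_w shrink_weight p w.
Proof.
move=> n0 [p0 [p1 pK]]; have [w cw] := core_vertex_exists n0 pK.
apply: (@sum_gt0 _ _ w) => [v|]; first exact: shrink_weight_ge0.
rewrite /shrink_weight (bigD1 (supp p)) /=; last exact/asboolP.
by rewrite ltr_wpDr ?level_weight_supp // sumr_ge0 // => S _; exact: level_weight_ge0.
Qed.

Lemma continuous_shrink p : (0 < n)%N -> realization (@rips_image n k) p ->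
  {for p, continuous shrink}.
Proof.
move=> n0 pK; apply: continuous_normalize; last by rewrite gt_eqF // shrink_weight_sum_gt0.
by move=> v; apply: continuous_sum_at => S; exact: continuous_level_weight.
Qed.

Lemma shrink_lift p l0 : (2 <= k)%N -> (2 * k < n)%N ->
  realization (@rips_image n k) p -> lift_on k l0 (supp p) ->
  exists l, [/\ forall w, w \in supp (shrink p) -> pi_eq (l w) w,
    forall w, w \in supp (shrink p) -> box_hull (lift_image l0 (supp p)) (l w) &
    (forall v w, v \in supp (shrink p) -> w \in supp (shrink p) ->
       l1dist (l v) (l w) <= k%:Z - 1) \/
    exists q, forall w, w \in supp (shrink p) -> unit_square q (l w)].
Proof.
move=> k2 kn pK l0p; have n0 : (0 < n)%N by lia.
apply: (core_lift (C := fun S => level_weight S p != 0)) => //.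
- by move=> S; exact: level_weight_sub.
- by move=> S T; exact: level_weight_chain.
move=> w; rewrite supp_normalize ?shrink_weight_sum_gt0 // finset.inE => wne.
apply: contrapT => h; move/negP: wne; apply; apply/eqP.
apply: big1 => S /asboolP cS; apply/eqP; apply: contraT => wS; case: h.
by exists S.
Qed.

(** The core vertices lift into the bounding box of the lifted support of [p], which still has
    diameter at most [k]. *)
Lemma shrink_union p : (2 <= k)%N -> (2 * k < n)%N ->
  realization (@rips_image n k) p -> rips_image k (supp p :|: supp (shrink p))%SET.
Proof.
move=> k2 kn pK; have [p0 [p1 [S0 [l0 l0p]]]] := pK.
have [l [lpi lhull _]] := shrink_lift k2 kn pK l0p.
apply: (rips_image_cover (X := box_hull (lift_image l0 (supp p)))).
- have /finset.set0Pn [v vp] := supp_nonempty p1.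
  by apply/finset.set0Pn; exists v; rewrite finset.inE vp.
- by apply: diam_box_hull => _ _ [v vS ->] [w wS ->]; exact: l0p.2.
move=> v; rewrite finset.inE => /orP [vp|vq]; last by exists (l v); [exact: lhull|exact: lpi].
by exists (l0 v); [apply: sub_box_hull; exists v|exact: l0p.1].
Qed.

Lemma realization_shrink p : (2 <= k)%N -> (2 * k < n)%N ->
  realization (@rips_image n k) p -> realization (@rips_image n k) (shrink p).
Proof.
move=> k2 kn pK; have [p0 [p1 _]] := pK; have n0 : (0 < n)%N by lia.
have sgt := shrink_weight_sum_gt0 n0 pK.
have s1 : \sum_v shrink p v = 1 by rewrite -mulr_suml divff // gt_eqF.
apply: realization_normalize => //; first by move=> v; exact: shrink_weight_ge0.
rewrite -supp_normalize //; apply: rips_imageS (shrink_union k2 kn pK) _ _.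
  exact: finset.subsetUr.
exact: supp_nonempty.
Qed.

End shrink.

(** * Barycenters on the torus *)

Lemma sum_supp (V : finType) (p F : V -> R) (c : R) : \sum_v p v = 1 ->
  (forall v, v \in supp p -> F v = c) -> \sum_v p v * F v = c.
Proof.
move=> p1 Fc; rewrite -[RHS]mul1r -p1 mulr_suml; apply: eq_bigr => v _.
have [|] := boolP (v \in supp p); first by move=> /Fc ->.
by rewrite supp0 => /eqP ->; rewrite !mul0r.
Qed.

Lemma sum_supp_le (V : finType) (p F : V -> R) (c : R) : \sum_v p v = 1 ->
  (forall v, 0 <= p v) ->
  (forall v, v \in supp p -> F v <= c) -> \sum_v p v * F v <= c.
Proof.
move=> p1 p0 Fc; rewrite -[leRHS]mul1r -p1 mulr_suml; apply: ler_sum => v _.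
have [|] := boolP (v \in supp p); first by move=> /Fc; exact: ler_wpM2l.
by rewrite supp0 => /eqP ->; rewrite !mul0r.
Qed.

Lemma sum_supp_ge (V : finType) (p F : V -> R) (c : R) : \sum_v p v = 1 ->
  (forall v, 0 <= p v) ->
  (forall v, v \in supp p -> c <= F v) -> c <= \sum_v p v * F v.
Proof.
move=> p1 p0 Fc; rewrite -lerN2 -sumrN.
under eq_bigr do rewrite -mulrN.
by apply: sum_supp_le => // v /Fc; rewrite lerN2.
Qed.

Section barycenter.
Context (n k : nat).
Implicit Types (p : {ptws 'I_n * 'I_n -> R}) (c : 'I_n * 'I_n -> 'I_n).

(* The representative of [b - a] modulo [n] lying in [-k, n - k). *)
Definition circ_diff (a b : 'I_n) : int :=
  modz ((b : nat)%:Z - (a : nat)%:Z + k%:Z) n%:Z - k%:Z.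

(** [c] is one of the two projections; this is the mean on the line as seen from the base vertex
    [v]. *)
Definition unrolled_mean c p (v : 'I_n * 'I_n) :=
  (c v : nat)%:R + \sum_w p w * (circ_diff (c v) (c w))%:~R.

(* On [|K|] all [v] in the support give the same point of the circle, so this
   convex combination is the barycenter, and no base vertex has to be chosen. *)
Definition circ_mean c p :=
  (\sum_v p v * cosn n (unrolled_mean c p v), \sum_v p v * sinn n (unrolled_mean c p v)).

Definition torus_mean p : (R * R) * (R * R) := (circ_mean fst p, circ_mean snd p).

Lemma circ_diffE (a b : 'I_n) (x y : int) : (2 * k < n)%N ->
  modz x n%:Z = (a : nat)%:Z -> modz y n%:Z = (b : nat)%:Z -> `|x - y| <= k%:Z ->
  circ_diff a b = y - x.
Proof.
move=> kn xa yb xy; rewrite /circ_diff -xa -yb.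
have -> : (y %% n)%Z - (x %% n)%Z + k%:Z =
    ((x %/ n)%Z - (y %/ n)%Z) * n%:Z + (y - x + k%:Z).
  by rewrite {3}(divz_eq x n) {3}(divz_eq y n); ring.
(* The bound on [x - y] puts [y - x + k] between 0 and [2 * k], below [n]. *)
by rewrite modzMDl modz_small; lia.
Qed.

Lemma circ_meanE c (h : 'I_n * 'I_n -> int) p : (2 * k < n)%N -> \sum_v p v = 1 ->
  (forall v, v \in supp p -> modz (h v) n%:Z = (c v : nat)%:Z) ->
  (forall v w, v \in supp p -> w \in supp p -> `|h v - h w| <= k%:Z) ->
  circ_mean c p = (cosn n (\sum_w p w * (h w)%:~R), sinn n (\sum_w p w * (h w)%:~R)).
Proof.
move=> kn p1 hc hk; have n0 : (0 < n)%N by lia.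
(* Every base vertex gives the mean of the lift up to a multiple of [n], invisible to [cosn] and
   [sinn]. *)
have mE v : v \in supp p ->
    unrolled_mean c p v = \sum_w p w * (h w)%:~R + (- (h v %/ n)%Z)%:~R * n%:R.
  move=> vp; rewrite /unrolled_mean.
  have -> : \sum_w p w * (circ_diff (c v) (c w))%:~R =
      \sum_w p w * (h w)%:~R - (h v)%:~R :> R.
    have -> : (h v)%:~R = \sum_w p w * (h v)%:~R :> R by rewrite -mulr_suml p1 mul1r.
    rewrite -sumrB; apply: eq_bigr => w _.
    have [wp|] := boolP (w \in supp p).
      by rewrite (circ_diffE kn (hc _ vp) (hc _ wp) (hk _ _ vp wp)) rmorphB mulrBr.
    by rewrite supp0 => /eqP ->; rewrite !mul0r subrr.
  rewrite {1}(divz_eq (h v) n) hc // rmorphD rmorphM rmorphN /=.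
  by rewrite -[((c v : nat)%:Z)%:~R]/((c v : nat)%:R) -[(n%:Z)%:~R]/(n%:R); ring.
by rewrite /circ_mean; congr (_, _); apply: sum_supp => // v /mE ->;
  rewrite ?cosn_periodic ?sinn_periodic.
Qed.

Definition lift_mean (l : 'I_n * 'I_n -> int * int) p :=
  (\sum_w p w * ((l w).1)%:~R, \sum_w p w * ((l w).2)%:~R).

Definition torus_point (z : R * R) : (R * R) * (R * R) :=
  ((cosn n z.1, sinn n z.1), (cosn n z.2, sinn n z.2)).

Lemma torus_meanE l p : (2 * k < n)%N -> \sum_v p v = 1 -> lift_on k l (supp p) ->
  torus_mean p = torus_point (lift_mean l p).
Proof.
move=> kn p1 [lpi lk]; rewrite /torus_mean /torus_point.
rewrite (circ_meanE (h := fun v => (l v).1) kn p1); first last.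
- by move=> v w vp wp; have := lk _ _ vp wp; rewrite /l1dist; lia.
- by move=> v /lpi [].
rewrite (circ_meanE (h := fun v => (l v).2) kn p1) //.
- by move=> v /lpi [].
- by move=> v w vp wp; have := lk _ _ vp wp; rewrite /l1dist; lia.
Qed.

Lemma torus_torus_point z : torus (torus_point z).
Proof. by split; exact: cosn2Dsinn2. Qed.

Lemma torus_torus_mean p : (2 * k < n)%N -> realization (@rips_image n k) p ->
  torus (torus_mean p).
Proof.
move=> kn [_ [p1 [_ [l lp]]]]; rewrite (torus_meanE kn p1 lp).
exact: torus_torus_point.
Qed.

Lemma torus_pointP zeta : (0 < n)%N -> torus zeta -> exists z, zeta = torus_point z.
Proof.
case: zeta => [[x1 y1] [x2 y2]] n0 [/= /(circle_param n0) [z1 [-> ->]]].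
by move=> /(circle_param n0) [z2 [-> ->]]; exists (z1, z2).
Qed.

(** Holds on the whole space: the values of [circ_diff] are constants, and the formula is otherwise
    built from coordinates by sums, products, cosine and sine. *)
Lemma continuous_torus_mean p : {for p, continuous torus_mean}.
Proof.
have cm c v : {for p, continuous (fun p' => unrolled_mean c p' v)}.
  apply: continuousD_at; first exact: cst_continuous.
  apply: continuous_sum_at => w; apply: continuousM_at; last exact: cst_continuous.
  exact: continuous_coord.
have cs (f : R -> R) c : continuous f -> {for p, continuous (fun p' : {ptws 'I_n * 'I_n -> R} =>
    \sum_v p' v * f (pi *+ 2 * (unrolled_mean c p' v / n%:R)))}.
  move=> fc; apply: continuous_sum_at => v; apply: continuousM_at; first exact: continuous_coord.
  apply: continuous_compR_at => //; apply: continuousM_at; first exact: cst_continuous.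
  by apply: continuousM_at; [exact: cm|exact: cst_continuous].
by do 2?apply: continuous_pair_at; apply: cs; [exact: continuous_cos|exact: continuous_sin
  |exact: continuous_cos|exact: continuous_sin].
Qed.

End barycenter.

(** * Rounding the torus to the grid *)

(** Convexity of the l1 distance to [a]. *)
Lemma lift_mean_dist (n : nat) (l : 'I_n * 'I_n -> int * int)
    (p : {ptws 'I_n * 'I_n -> R}) (a : int * int) (m : int) :
  (forall v, 0 <= p v) -> \sum_v p v = 1 ->
  (forall w, w \in supp p -> l1dist (l w) a <= m) ->
  `|(lift_mean l p).1 - a.1%:~R| + `|(lift_mean l p).2 - a.2%:~R| <= m%:~R.
Proof.
move=> p0 p1 la; have D (h : 'I_n * 'I_n -> int) (b : int) :
    `|\sum_w p w * (h w)%:~R - b%:~R| <= \sum_w p w * (`|h w - b|)%:~R.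
  have -> : b%:~R = \sum_w p w * b%:~R :> R by rewrite -mulr_suml p1 mul1r.
  rewrite -sumrB; apply: le_trans (ler_norm_sum _ _ _) _; apply: ler_sum => w _.
  by rewrite -mulrBr normrM (ger0_norm (p0 w)) -rmorphB /= intr_norm.
apply: le_trans (lerD (D (fun w => (l w).1) a.1) (D (fun w => (l w).2) a.2)) _.
rewrite -big_split /=; under eq_bigr do rewrite -mulrDr -rmorphD.
by apply: sum_supp_le => // w /la; rewrite ler_int.
Qed.

Definition near_point (z : R * R) (y : int * int) :=
  `|z.1 - y.1%:~R| < 1 /\ `|z.2 - y.2%:~R| < 1.

Lemma near_point_dist z x y : near_point z x -> near_point z y -> l1dist x y <= 2.
Proof.
move=> [x1 x2] [y1 y2].
have D (a b : int) (t : R) : `|t - a%:~R| < 1 -> `|t - b%:~R| < 1 -> `|a - b| <= 1.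
  move=> ha hb; suff : `|a - b| < 2 by lia.
  rewrite -(ltr_int R) intr_norm rmorphB /=.
  have := ler_distD t (a%:~R : R) b%:~R; rewrite (distrC _ t); lra.
have := D _ _ _ x1 y1; have := D _ _ _ x2 y2; rewrite /l1dist; lia.
Qed.

(** The strict inequalities of [near_point] exclude the integers next to the closed interval. *)
Lemma near_point_unit_square z q y :
  q.1%:~R <= z.1 <= q.1%:~R + 1 -> q.2%:~R <= z.2 <= q.2%:~R + 1 ->
  near_point z y -> unit_square q y.
Proof.
have D (a b : int) (t : R) : a%:~R <= t <= a%:~R + 1 -> `|t - b%:~R| < 1 -> a <= b <= a + 1.
  move=> ha; rewrite ltr_norml => hb; suff : a - 1 < b < a + 2 by lia.
  by rewrite -!(ltr_int R) rmorphB rmorphD /=; lra.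
by move=> h1 h2 [y1 y2]; split; [exact: D h1 y1|exact: D h2 y2].
Qed.

Lemma unit_square_dist q x y : unit_square q x -> unit_square q y -> l1dist x y <= 2.
Proof. by rewrite /unit_square /l1dist; lia. Qed.

Lemma lift_mean_unit_square (n : nat) (l : 'I_n * 'I_n -> int * int)
    (p : {ptws 'I_n * 'I_n -> R}) q :
  (forall v, 0 <= p v) -> \sum_v p v = 1 ->
  (forall w, w \in supp p -> unit_square q (l w)) ->
  q.1%:~R <= (lift_mean l p).1 <= q.1%:~R + 1 /\
  q.2%:~R <= (lift_mean l p).2 <= q.2%:~R + 1.
Proof.
move=> p0 p1 lq; split; apply/andP; split.
- by apply: sum_supp_ge => // w /lq [/andP [h _] _]; rewrite ler_int.
- by apply: sum_supp_le => // w /lq [/andP [_ h] _]; rewrite -(intrD _ _ 1) ler_int.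
- by apply: sum_supp_ge => // w /lq [_ /andP [h _]]; rewrite ler_int.
- by apply: sum_supp_le => // w /lq [_ /andP [_ h]]; rewrite -(intrD _ _ 1) ler_int.
Qed.

Section grid.
Context (n k : nat).
Hypotheses (k2 : (2 <= k)%N) (kn : (2 * k < n)%N).

Let n0 : (0 < n)%N. Proof. by move: k2 kn; lia. Qed.
Let n2 : (2 <= n)%N. Proof. by move: k2 kn; lia. Qed.

(** On the circle, the inner product of [zeta] with the vertex [i], cut off at the cosine of one
    step: positive exactly at circular distance less than 1 from [i]. No angle of [zeta] is chosen,
    so continuity is immediate. *)
Definition hat (zeta : R * R) (i : 'I_n) :=
  Num.max 0 (zeta.1 * cosn n (i : nat)%:R + zeta.2 * sinn n (i : nat)%:R - cosn n 1).

Lemma hat_ge0 zeta i : 0 <= hat zeta i.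
Proof. by rewrite le_max lexx. Qed.

Lemma hat_neq0 (z : R) (i : 'I_n) : hat (cosn n z, sinn n z) i != 0 <->
  exists2 y : int, modz y n%:Z = (i : nat)%:Z & `|z - y%:~R| < 1.
Proof.
have -> : (hat (cosn n z, sinn n z) i != 0) = (cosn n 1 < cosn n (z - (i : nat)%:R)).
  by rewrite -[LHS]andbT -(hat_ge0 (cosn n z, sinn n z) i) -lt0r lt_max ltxx /= -cosnB subr_gt0.
split=> [/(cosn_gt_near n2) [m hm]|[y yi hy]].
  exists ((- m) * n%:Z + (i : nat)%:Z); first by rewrite modzMDl modz_small // ltz_nat ltn_ord.
  by rewrite rmorphD rmorphM rmorphN /= opprD mulNr opprK addrCA addrC addrAC in hm *.
have -> : z - (i : nat)%:R = z - y%:~R + (y %/ n)%Z%:~R * n%:R.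
  rewrite {1}(divz_eq y n) yi rmorphD rmorphM /=.
  by rewrite -[((i : nat)%:Z)%:~R]/((i : nat)%:R) -[(n%:Z)%:~R]/(n%:R); ring.
by rewrite cosn_periodic //; exact: near_cosn_gt.
Qed.

Definition square_weight (zeta : (R * R) * (R * R)) (v : 'I_n * 'I_n) :=
  hat zeta.1 v.1 * hat zeta.2 v.2.

Definition grid zeta : {ptws 'I_n * 'I_n -> R} := normalize (square_weight zeta).

Lemma square_weight_ge0 zeta v : 0 <= square_weight zeta v.
Proof. by rewrite mulr_ge0 // hat_ge0. Qed.

Lemma supp_square_weight z v : v \in supp (square_weight (torus_point n z)) <->
  exists2 y, pi_eq y v & near_point z y.
Proof.
rewrite finset.inE mulf_eq0 negb_or; split.
  move=> /andP [/hat_neq0 [y1 p1 h1] /hat_neq0 [y2 p2 h2]].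
  by exists (y1, y2).
by move=> [[y1 y2] [p1 p2] [h1 h2]]; apply/andP; split; apply/hat_neq0;
  [exists y1|exists y2].
Qed.

Lemma near_floor z : near_point z (Num.floor z.1, Num.floor z.2).
Proof.
have D (t : R) : `|t - (Num.floor t)%:~R| < 1.
  have := floor_itv t; rewrite rmorphD /= => h.
  by rewrite ltr_norml; lra.
by split; exact: D.
Qed.

Lemma square_weight_sum_gt0 zeta : torus zeta -> 0 < \sum_v square_weight zeta v.
Proof.
move=> /(torus_pointP n0) [z ->].
have [v hv] := pi_eq_exists (Num.floor z.1, Num.floor z.2) n0.
have : v \in supp (square_weight (torus_point n z)).
  by apply/supp_square_weight; eexists; [exact: hv|exact: near_floor].
rewrite finset.inE => vs; apply: (@sum_gt0 _ _ v) => [w|]; first exact: square_weight_ge0.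
by rewrite lt0r vs square_weight_ge0.
Qed.

Lemma supp_grid z v : v \in supp (grid (torus_point n z)) <->
  exists2 y, pi_eq y v & near_point z y.
Proof.
rewrite supp_normalize; first exact: supp_square_weight.
by apply: square_weight_sum_gt0; exact: torus_torus_point.
Qed.

Lemma sum_grid zeta : torus zeta -> \sum_v grid zeta v = 1.
Proof. by move=> /square_weight_sum_gt0 h; rewrite -mulr_suml divff // gt_eqF. Qed.

Lemma realization_grid zeta : torus zeta -> realization (@rips_image n k) (grid zeta).
Proof.
move=> tz; apply: realization_normalize; first exact: square_weight_ge0.
  exact: square_weight_sum_gt0.
rewrite -supp_normalize; last exact: square_weight_sum_gt0.
(* [cid] picks a point of the plane over [zeta]; the lattice points near it cover the support. *)
apply: (rips_image_cover (X := near_point (projT1 (cid (torus_pointP n0 tz))))).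
- by apply: supp_nonempty; exact: sum_grid.
- by move=> x y hx hy; apply: le_trans (near_point_dist hx hy) _; lia.
case: cid => z /= zE v; rewrite -/(grid zeta) {1}zE.
by move=> /supp_grid [y ? ?]; exists y.
Qed.

Lemma continuous_grid zeta : torus zeta -> {for zeta, continuous grid}.
Proof.
move=> tz; apply: continuous_normalize; last by rewrite gt_eqF // square_weight_sum_gt0.
move=> v; apply: continuousM_at; apply: continuous_max0_at; apply: continuousB_at;
  try exact: cst_continuous; apply: continuousD_at; apply: continuousM_at;
  try exact: cst_continuous.
- by apply: continuous_comp; exact: cvg_fst.
- by apply: (@continuous_comp _ _ _ fst snd); [exact: cvg_fst|exact: cvg_snd].
- by apply: (@continuous_comp _ _ _ snd fst); [exact: cvg_snd|exact: cvg_fst].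
- by apply: continuous_comp; exact: cvg_snd.
Qed.

(* Rounding moves a point by less than 2 in the l1 metric, which the slack
   [k - 1] turns into distance less than [k + 1], hence at most [k]. *)
Lemma union_grid_mean l p : realization (@rips_image n k) p ->
  (forall w, w \in supp p -> pi_eq (l w) w) ->
  (forall v w, v \in supp p -> w \in supp p -> l1dist (l v) (l w) <= k%:Z - 1) \/
  (exists q, forall w, w \in supp p -> unit_square q (l w)) ->
  rips_image k (supp p :|: supp (grid (torus_mean k p)))%SET.
Proof.
move=> [p0 [p1 _]] lpi H.
have lp : lift_on k l (supp p).
  split=> // v w vp wp; case: H => [/(_ _ _ vp wp)|[q hq]]; first by lia.
  by apply: le_trans (unit_square_dist (hq _ vp) (hq _ wp)) _; lia.
rewrite (torus_meanE kn p1 lp); set z := lift_mean l p.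
apply: (rips_image_cover
  (X := fun y => (exists2 w, w \in supp p & y = l w) \/ near_point z y)).
- have /finset.set0Pn [v vp] := supp_nonempty p1.
  by apply/finset.set0Pn; exists v; rewrite finset.inE vp.
- have mixed w y : w \in supp p -> near_point z y -> l1dist (l w) y <= k%:Z.
    move=> wp; case: H => [h|[q hq]] zy.
      have [y1 y2] := zy; suff : l1dist (l w) y < k%:Z + 1 by lia.
      have := lift_mean_dist p0 p1 (fun v vp => h v w vp wp); rewrite -/z => hz.
      rewrite -(ltr_int R) /l1dist rmorphD /= !intr_norm !rmorphB rmorphD /=.
      have := ler_distD z.1 ((l w).1%:~R : R) y.1%:~R.
      have := ler_distD z.2 ((l w).2%:~R : R) y.2%:~R.
      move: hz; rewrite rmorphB /= (distrC _ z.1) (distrC _ z.2); lra.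
    (* The barycenter stays in the unit square, hence so does its rounding, and the square has
       diameter 2. *)
    have [z1 z2] := lift_mean_unit_square p0 p1 hq.
    apply: le_trans (unit_square_dist (hq _ wp) (near_point_unit_square z1 z2 zy)) _.
    by lia.
  move=> x y [[v vp ->]|zx] [[w wp ->]|zy].
  + exact: lp.2.
  + exact: mixed.
  + by rewrite l1distC; exact: mixed.
  + by apply: le_trans (near_point_dist zx zy) _; lia.
move=> v; rewrite finset.inE => /orP [vp|/supp_grid [y yv zy]].
  by exists (l v); [left; exists v|exact: lpi].
by exists y => //; right.
Qed.

(** The support of the grid point lifts into the unit square at the floor of [z]. Bounding boxes and
    barycenters stay in that square, which also contains [z]. *)
Lemma torus_mean_shrink_grid z : exists2 z' : R * R,
  torus_mean k (shrink k (grid (torus_point n z))) = torus_point n z' &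
  `|z'.1 - z.1| <= 1 /\ `|z'.2 - z.2| <= 1.
Proof.
set p := grid (torus_point n z); have pK := realization_grid (torus_torus_point n z).
pose q := (Num.floor z.1, Num.floor z.2).
have fl (t : R) : (Num.floor t)%:~R <= t <= (Num.floor t)%:~R + 1.
  by have := floor_itv t; rewrite rmorphD /= => ?; apply/andP; lra.
have /choice [l0 hl0] : forall v, exists y, v \in supp p -> pi_eq y v /\ near_point z y.
  move=> v; case: (boolP (v \in supp p)) => [/supp_grid [y]|_]; last by exists (0, 0).
  by exists y.
have l0q v : v \in supp p -> unit_square q (l0 v).
  by move=> /hl0 [_]; apply: near_point_unit_square; exact: fl.
have l0p : lift_on k l0 (supp p).
  split=> [v /hl0 []//|v w /l0q vq /l0q wq].
  by apply: le_trans (unit_square_dist vq wq) _; lia.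
have [l [lpi lhull _]] := shrink_lift k2 kn pK l0p.
have lq w : w \in supp (shrink k p) -> unit_square q (l w).
  by move=> /lhull; apply: box_hull_unit_square => _ [v /l0q ? ->].
have [s0 [s1 _]] := realization_shrink k2 kn pK.
have lS : lift_on k l (supp (shrink k p)).
  split=> [v /lpi//|v w /lq vq /lq wq].
  by apply: le_trans (unit_square_dist vq wq) _; lia.
exists (lift_mean l (shrink k p)); first exact: torus_meanE.
have [h1 h2] := lift_mean_unit_square s0 s1 lq; have f1 := fl z.1; have f2 := fl z.2.
by rewrite /q /= in h1 h2; split=> /=; rewrite ler_norml; lra.
Qed.

End grid.

(** * The homotopy equivalence *)

Definition sqnorm (a : R * R) := a.1 ^+ 2 + a.2 ^+ 2.

Definition unit_vector (a : R * R) := (a.1 / Num.sqrt (sqnorm a), a.2 / Num.sqrt (sqnorm a)).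

Definition segment (t : R) (a b : R * R) :=
  ((1 - t) * a.1 + t * b.1, (1 - t) * a.2 + t * b.2).

Lemma unit_vector_id a : sqnorm a = 1 -> unit_vector a = a.
Proof. by case: a => x y; rewrite /unit_vector => ->; rewrite sqrtr1 !divr1. Qed.

Lemma sqnorm_unit_vector a : 0 < sqnorm a -> sqnorm (unit_vector a) = 1.
Proof.
move=> a0; rewrite /sqnorm /= !expr_div_n !sqr_sqrtr ?ltW // -mulrDl.
by rewrite divff // gt_eqF.
Qed.

Lemma sqnorm_segment_gt0 t a b : 0 <= t -> t <= 1 -> sqnorm a = 1 -> sqnorm b = 1 ->
  0 < a.1 * b.1 + a.2 * b.2 -> 0 < sqnorm (segment t a b).
Proof.
move=> t0 t1 a1 b1 ab.
have -> : sqnorm (segment t a b) =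
    (1 - t) ^+ 2 * sqnorm a + t ^+ 2 * sqnorm b + 2 * (t * (1 - t)) * (a.1 * b.1 + a.2 * b.2).
  by rewrite /sqnorm /segment /=; ring.
rewrite a1 b1 !mulr1 ltr_wpDr //; last by nra.
by rewrite mulr_ge0 ?(ltW ab) // mulr_ge0 // mulr_ge0 // subr_ge0.
Qed.

Lemma continuous_unit_vector (X : topologicalType) (x : X) (f g : X -> R) :
  {for x, continuous f} -> {for x, continuous g} -> 0 < sqnorm (f x, g x) ->
  {for x, continuous (fun y => unit_vector (f y, g y))}.
Proof.
move=> fc gc pos.
have nc : {for x, continuous (fun y => Num.sqrt (sqnorm (f y, g y)))}.
  apply: continuous_compR_at; first exact: sqrt_continuous.
  by apply: continuousD_at; exact: continuousM_at.
by apply: continuous_pair_at; apply: continuous_div_at => //; rewrite gt_eqF // sqrtr_gt0.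
Qed.

(** Positive inner products keep the segment from [f z] to [z] away from the origin in each circle
    factor, so it can be normalized. *)
Lemma homotopic_torus_id (f : (R * R) * (R * R) -> (R * R) * (R * R)) :
  (forall z, torus z -> {for z, continuous f}) ->
  (forall z, torus z -> torus (f z)) ->
  (forall z, torus z -> 0 < (f z).1.1 * z.1.1 + (f z).1.2 * z.1.2 /\
                        0 < (f z).2.1 * z.2.1 + (f z).2.2 * z.2.2) ->
  homotopic torus torus f id.
Proof.
move=> fc ft fpos.
pose H (p : R * ((R * R) * (R * R))) :=
  (unit_vector (segment p.1 (f p.2).1 p.2.1), unit_vector (segment p.1 (f p.2).2 p.2.2)).
have pos t z : 0 <= t -> t <= 1 -> torus z -> 0 < sqnorm (segment t (f z).1 z.1) /\
    0 < sqnorm (segment t (f z).2 z.2).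
  move=> t0 t1 tz; have [z1 z2] := tz; have [f1 f2] := ft z tz; have [p1 p2] := fpos z tz.
  by split; exact: sqnorm_segment_gt0.
exists H; split; [apply: cont_map_at|split].
- move=> [t z] [/= [/RleP t0 /RleP t1] tz].
  have [n1 n2] := pos t z t0 t1 tz.
  have tc : {for (t, z), continuous (fun p : R * ((R * R) * (R * R)) => p.1)} by exact: cvg_fst.
  have sc : {for (t, z), continuous (fun p : R * ((R * R) * (R * R)) => 1 - p.1)}.
    by apply: continuousB_at => //; exact: cst_continuous.
  have fcomp (g : (R * R) * (R * R) -> R) (h : (R * R) * (R * R) -> (R * R) * (R * R)) :
      continuous g -> {for z, continuous h} ->
      {for (t, z), continuous (fun p : R * ((R * R) * (R * R)) => g (h p.2))}.
    move=> gc hc; apply: (@continuous_comp _ _ _ snd (fun y => g (h y))); first exact: cvg_snd.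
    by apply: continuous_comp => //; exact: gc.
  have idc : {for z, continuous (fun y : (R * R) * (R * R) => y)} by exact: cvg_id.
  have fz := fc z tz.
  have c11 : continuous (fun y : (R * R) * (R * R) => y.1.1).
    by move=> y; apply: continuous_comp; exact: cvg_fst.
  have c12 : continuous (fun y : (R * R) * (R * R) => y.1.2).
    by move=> y; apply: (@continuous_comp _ _ _ fst snd); [exact: cvg_fst|exact: cvg_snd].
  have c21 : continuous (fun y : (R * R) * (R * R) => y.2.1).
    by move=> y; apply: (@continuous_comp _ _ _ snd fst); [exact: cvg_snd|exact: cvg_fst].
  have c22 : continuous (fun y : (R * R) * (R * R) => y.2.2).
    by move=> y; apply: continuous_comp; exact: cvg_snd.
  have segc (g : (R * R) * (R * R) -> R) : continuous g ->
      {for (t, z), continuous (fun p : R * ((R * R) * (R * R)) =>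
        (1 - p.1) * g (f p.2) + p.1 * g p.2)}.
    move=> gc; apply: continuousD_at.
      by apply: continuousM_at; [exact: sc|exact: fcomp gc fz].
    by apply: continuousM_at; [exact: tc|exact: fcomp gc idc].
  exact: continuous_pair_at (continuous_unit_vector (segc _ c11) (segc _ c12) n1)
    (continuous_unit_vector (segc _ c21) (segc _ c22) n2).
- move=> [t z] [/= [/RleP t0 /RleP t1] tz].
  by have [n1 n2] := pos t z t0 t1 tz; split; exact: sqnorm_unit_vector.
- move=> z tz; change (H (0, z) = f z); have [f1 f2] := ft z tz.
  have seg a b : segment 0 a b = a.
    by rewrite /segment subr0 !mul0r !addr0 !mul1r -surjective_pairing.
  by rewrite /H /= !seg !unit_vector_id // -surjective_pairing.
- move=> z tz; change (H (1, z) = z); have [z1 z2] := tz.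
  have seg a b : segment 1 a b = b.
    by rewrite /segment subrr !mul0r !add0r !mul1r -surjective_pairing.
  by rewrite /H /= !seg !unit_vector_id // -surjective_pairing.
Qed.

(** A displacement of at most 1 is less than the quarter turn [n / 4]. *)
Lemma cosn_gt0 (n : nat) (t : R) : (5 <= n)%N -> `|t| <= 1 -> 0 < cosn n t.
Proof.
move=> n5 t1; have nR : 5 <= n%:R :> R by rewrite ler_nat.
have <- : cosn n (n%:R / 4) = 0 :> R.
  rewrite /cosn mulrAC divff ?pnatr_eq0; last by lia.
  by rewrite mul1r (_ : pi *+ 2 / 4 = pi / 2) ?cos_pihalf // -mulr_natr; field.
have q0 : 0 <= n%:R / 4 :> R by lra.
by rewrite cosn_gt ?(ger0_norm q0) //; lia || lra.
Qed.

Lemma rips_image_homotopy_equiv (n k : nat) : (2 <= k)%N -> (2 * k < n)%N ->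
  homotopy_equiv (realization (@rips_image n k)) torus.
Proof.
move=> k2 kn; have n0 : (0 < n)%N by lia.
pose K := realization (@rips_image n k).
pose F (p : {ptws 'I_n * 'I_n -> R}) := torus_mean k (shrink k p).
have shK p : K p -> K (shrink k p) by exact: realization_shrink.
have shc p : K p -> {for p, continuous (@shrink n k)} by exact: continuous_shrink.
have FT p : K p -> torus (F p) by move=> /shK; exact: torus_torus_mean.
have Fc p : K p -> {for p, continuous F}.
  by move=> Kp; apply: continuous_comp; [exact: shc|exact: continuous_torus_mean].
have gK z : torus z -> K (grid z) by exact: realization_grid.
have gc z : torus z -> {for z, continuous (@grid n)} by exact: (continuous_grid k2 kn).
exists F, (@grid n); split; [exact: cont_map_at|split; [exact: cont_map_at|split]].
  (* [shrink k p] is the intermediate point: it spans a simplex with [p] and another one with the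
     rounding of its own mean. *)
  apply: (homotopic_contiguous (b := @shrink n k)).
  + by move=> S T; exact: rips_imageS.
  + by move=> p Kp; apply: continuous_comp; [exact: Fc|apply: gc; exact: FT].
  + exact: shc.
  + by move=> p _; exact: cvg_id.
  + by move=> p Kp; apply: gK; exact: FT.
  + exact: shK.
  + by [].
  + move=> p Kp; have [p0 [p1 [S0 [l0 l0p]]]] := Kp.
    have [l [lpi _ lk]] := shrink_lift k2 kn Kp l0p.
    by rewrite finset.setUC; apply: union_grid_mean lpi lk => //; exact: shK.
  + by move=> p Kp; rewrite finset.setUC; exact: shrink_union.
apply: homotopic_torus_id => z tz.
- by apply: continuous_comp; [exact: gc|apply: Fc; exact: gK].
- by apply: FT; exact: gK.
(* This composite moves each coordinate by at most 1, less than a quarter turn since [2 <= k] and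
   [2 * k < n] give [5 <= n]. *)
have [w ->] := torus_pointP n0 tz.
have [w' e [h1 h2]] := torus_mean_shrink_grid k2 kn w.
have -> : (F \o @grid n) (torus_point n w) = torus_point n w' by exact: e.
by split; rewrite /= -cosnB; apply: cosn_gt0 => //; lia.
Qed.

Theorem theorem5p8 (k n : nat) :
  (2 <= k)%N -> (2 * k < n)%N ->
  homotopy_equiv (realization (@K_complex n k)) torus /\
  ((3 * k < n)%N -> homotopy_equiv (realization (@VR_torus n k)) torus).
Proof.
move=> k2 kn.
have KE : @K_complex n k = @rips_image n k.
  by apply/funext => S; apply/propext; exact: K_complexE.
split=> [|kn3]; first by rewrite KE; exact: rips_image_homotopy_equiv.
have -> : @VR_torus n k = @rips_image n k.
  by apply/funext => S; apply/propext; exact: VR_torusE.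
exact: rips_image_homotopy_equiv.
Qed.
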